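(* Let $A: X \supseteq \operatorname{dom}(A) \to X$ be the generator of a positive $C_0$-semigroup on an ordered Banach space $(X,X^+)$ with total cone $X^+$. Assume that the essential spectrum $\sigma_{\mathrm{ess}}(A)$ is empty or that $s_{\mathrm{ess}}(A) < s(A)$. Let $n \ge 0$ be an integer and let $F \neq \emptyset$ be a set of positive and continuous functionals on $\operatorname{dom}(A^n)$ that determines positivity. Then $s(A) < \infty$ and $$ s(A) = \sup_{0 \lneq x \in \operatorname{dom}(A^{n+1})}\ \inf_{x' \in F,\ \langle x',x\rangle \neq 0} \frac{\langle x', Ax\rangle}{\langle x', x\rangle}. $$
   Context: An ordered Banach space $(X,X^+)$ is a real Banach space $X$ together with a closed convex cone $X^+$ (so $X^+ + X^+ \subseteq X^+$ and $[0,\infty)X^+ \subseteq X^+$) with $X^+ \cap (-X^+) = \{0\}$; $x\le y$ means $y-x\in X^+$, and $0\lneq x$ means $0\le x$ and $x\ne 0$. The cone is total if $X^+ - X^+$ is dense in $X$. A $C_0$-semigroup $(e^{tA})_{t\ge0}$ is positive if $e^{tA}X^+\subseteq X^+$ for all $t\ge0$. Spectral notions for $A$ refer to the canonical extension of $A$ to a complexification of $X$. The spectral bound is $s(A) := \sup\{\operatorname{Re}\lambda:\lambda\in\sigma(A)\}\in[-\infty,\infty]$. The essential spectrum $\sigma_{\mathrm{ess}}(A)$ is the set of $\lambda\in\mathbb{C}$ such that $\lambda\,\mathrm{id} - A$, as a bounded operator from $\operatorname{dom}(A)$ (with the graph norm) to the underlying Banach space, is not Fredholm (Fredholm: finite-dimensional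 kernel and range of finite codimension), and $s_{\mathrm{ess}}(A) := \sup\{\operatorname{Re}\lambda:\lambda\in\sigma_{\mathrm{ess}}(A)\}$. Convention: $\sup\emptyset=-\infty$ (both sides of the formula may equal $-\infty$). A linear functional $x':\operatorname{dom}(A^n)\to\mathbb{R}$ is called continuous if it is continuous with respect to the graph norm on $\operatorname{dom}(A^n)$ (where $\operatorname{dom}(A^0)=X$ with its norm), and positive if $\langle x',x\rangle\ge0$ for all $x\in\operatorname{dom}(A^n)\cap X^+$. A set $F$ of continuous and positive functionals on $\operatorname{dom}(A^n)$ determines positivity if for each $x\in\operatorname{dom}(A^n)$: whenever $\langle x',x\rangle\ge0$ for all $x'\in F$, then $x\ge0$. *)

(* Defs.v *)
From HB Require Import structures.
From mathcomp Require Import all_boot all_order all_algebra.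
From mathcomp Require Import all_classical all_reals all_analysis.
From mathcomp Require Import complex.
Set Implicit Arguments.
Unset Strict Implicit.
Unset Printing Implicit Defensive.
Import Order.TTheory GRing.Theory Num.Theory.
Import numFieldNormedType.Exports.
Local Open Scope classical_set_scope.
Local Open Scope ring_scope.

(** [op] is total, but its values outside [dom] are irrelevant. *)
Record operator (K : pzRingType) (E : lmodType K) := Operator {
  dom : set E;
  op :> E -> E
}.

Definition op_id (K : pzRingType) (E : lmodType K) : operator E :=
  Operator setT id.

Definition op_comp (K : pzRingType) (E : lmodType K) (A B : operator E) :
    operator E :=
  Operator [set x | dom B x /\ dom A (B x)] (A \o B).

Definition op_pow (K : pzRingType) (E : lmodType K) (A : operator E) (n : nat) :
    operator E :=
  iter n (op_comp A) (op_id E).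

Definition shift_op (K : pzRingType) (E : lmodType K) (lambda : K)
    (A : operator E) : operator E :=
  Operator (dom A) (fun x => lambda *: x - A x).

Definition lspan (K : pzRingType) (E : lmodType K) (n : nat) (b : 'I_n -> E) :
    set E :=
  [set x | exists c : 'I_n -> K, x = \sum_(i < n) c i *: b i].

Definition finite_dim (K : pzRingType) (E : lmodType K) (V : set E) :=
  exists (n : nat) (b : 'I_n -> E), V `<=` lspan b.

Definition finite_codim (K : pzRingType) (E : lmodType K) (V : set E) :=
  exists (n : nat) (b : 'I_n -> E),
    forall x, exists v w, [/\ V v, lspan b w & x = v + w].

Definition op_ker (K : pzRingType) (E : lmodType K) (B : operator E) : set E :=
  [set x | dom B x /\ B x = 0].

Definition op_range (K : pzRingType) (E : lmodType K) (B : operator E) : set E :=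
  B @` dom B.

Definition fredholm (K : pzRingType) (E : lmodType K) (B : operator E) :=
  finite_dim (op_ker B) /\ finite_codim (op_range B).

(** The pair [(x, y)] stands for [x + i y]. *)
Definition complexification (R : realType) (X : normedModType R) : Type :=
  (X * X)%type.

Section Complexification.
Variables (R : realType) (X : normedModType R).

HB.instance Definition _ :=
  GRing.Zmodule.copy (complexification X) (X * X)%type.

Definition zscale (lambda : R[i]) (z : complexification X) :
    complexification X :=
  (complex.Re lambda *: z.1 - complex.Im lambda *: z.2,
   complex.Im lambda *: z.1 + complex.Re lambda *: z.2).

Lemma zscaleA (a b : R[i]) (z : complexification X) :
  zscale a (zscale b z) = zscale (a * b) z.
Proof.
case: a b z => [a1 a2] [b1 b2] [x y]; rewrite /zscale /=.
rewrite !(scalerDr, scalerDl, scalerN, scaleNr, scalerA) !opprD.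
congr pair; rewrite addrACA //.
by congr (_ + _); rewrite addrC.
Qed.

Lemma zscale1 : left_id 1 zscale.
Proof. by case=> x y; rewrite /zscale /= !scale1r !scale0r subr0 add0r. Qed.

Lemma zscaleDr : right_distributive zscale +%R.
Proof.
move=> [a1 a2] [x y] [x' y']; rewrite /zscale /=.
by congr pair; rewrite !scalerDr ?opprD addrACA.
Qed.

Lemma zscaleDl (z : complexification X) :
  {morph zscale^~ z : a b / a + b}.
Proof.
move=> [a1 a2] [b1 b2]; rewrite /zscale /=.
by congr pair; rewrite !scalerDl ?opprD addrACA.
Qed.

HB.instance Definition _ := GRing.Zmodule_isLmodule.Build R[i]
  (complexification X) zscaleA zscale1 zscaleDr zscaleDl.

(** The product norm is only real-homogeneous, but it is equivalent to every
    complexification norm, so that it yields the same bounded operators. *)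
Definition cnorm (z : complexification X) : R := `|(z : (X * X)%type)|.

Definition complexify (A : operator X) : operator (complexification X) :=
  @Operator _ (complexification X) [set z | dom A z.1 /\ dom A z.2]
    (fun z => (A z.1, A z.2)).

End Complexification.

Definition resolvent_set (R : realType) (X : normedModType R)
    (A : operator X) : set R[i] :=
  [set lambda | let B := shift_op lambda (complexify A) in
    exists S : complexification X -> complexification X,
      [/\ forall y, dom B (S y) /\ B (S y) = y,
          forall x, dom B x -> S (B x) = x &
          exists M : R, forall y, cnorm (S y) <= M * cnorm y]].

Definition spectrum (R : realType) (X : normedModType R)
    (A : operator X) : set R[i] :=
  ~` resolvent_set A.

Definition ess_spectrum (R : realType) (X : normedModType R)
    (A : operator X) : set R[i] :=
  [set lambda | ~ fredholm (shift_op lambda (complexify A))].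

Definition sup_re (R : realType) (S : set R[i]) : \bar R :=
  ereal_sup [set (complex.Re lambda)%:E | lambda in S].

Definition spectral_bound (R : realType) (X : normedModType R)
    (A : operator X) : \bar R :=
  sup_re (spectrum A).

Definition ess_spectral_bound (R : realType) (X : normedModType R)
    (A : operator X) : \bar R :=
  sup_re (ess_spectrum A).

(** Only the values [T t] with [0 <= t] are relevant. *)
Definition C0_semigroup (R : realType) (X : normedModType R)
    (T : R -> X -> X) :=
  [/\ forall t, 0 <= t -> linear (T t) /\ continuous (T t),
      T 0 = id,
      forall s t, 0 <= s -> 0 <= t -> T (s + t) = T s \o T t &
      forall x, T t x @[t --> 0^'+] --> x].

Definition is_generator (R : realType) (X : normedModType R)
    (T : R -> X -> X) (A : operator X) :=
  let dq x := fun h : R => h^-1 *: (T h x - x) in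
  (forall x, dom A x <-> exists y : X, dq x h @[h --> 0^'+] --> y) /\
  (forall x, dom A x -> dq x h @[h --> 0^'+] --> A x).

(** [x <= y] means [C (y - x)], so [C x] reads [0 <= x]. *)
Definition ordering_cone (R : realType) (X : normedModType R) (C : set X) :=
  [/\ closed C,
      forall x y, C x -> C y -> C (x + y),
      forall (a : R) x, 0 <= a -> C x -> C (a *: x) &
      C `&` [set - x | x in C] = [set 0]].

Definition total_cone (R : realType) (X : normedModType R) (C : set X) :=
  dense [set z | exists x y, [/\ C x, C y & z = x - y]].

Definition positive_semigroup (R : realType) (X : normedModType R)
    (C : set X) (T : R -> X -> X) :=
  forall t x, 0 <= t -> C x -> C (T t x).

(** For [B = op_pow A 0 = op_id X] this is twice the norm of [X], which has the
    same continuous functionals. *)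
Definition graph_norm (R : realType) (X : normedModType R) (B : operator X)
    (x : X) : R :=
  `|x| + `|B x|.

(** Functionals on [dom B] are total functions whose values outside [dom B] are
    irrelevant. *)
Definition linear_functional (R : realType) (X : normedModType R)
    (B : operator X) (f : X -> R) :=
  forall (a : R) x y, dom B x -> dom B y -> f (a *: x + y) = a * f x + f y.

Definition continuous_functional (R : realType) (X : normedModType R)
    (B : operator X) (f : X -> R) :=
  forall x, dom B x -> forall e : R, 0 < e -> exists2 d : R, 0 < d &
    forall y, dom B y -> graph_norm B (y - x) < d -> `|f y - f x| < e.

Definition positive_functional (R : realType) (X : normedModType R)
    (C : set X) (B : operator X) (f : X -> R) :=
  forall x, dom B x -> C x -> 0 <= f x.

Definition determines_positivity (R : realType) (X : normedModType R)
    (C : set X) (B : operator X) (F : set (X -> R)) :=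
  forall x, dom B x -> (forall f, F f -> 0 <= f x) -> C x.

(* Main.v *)
Require Import Defs.
From HB Require Import structures.
From mathcomp Require Import all_boot all_order all_algebra.
From mathcomp Require Import all_classical all_reals all_analysis.
From mathcomp Require Import complex ring lra.
Set Implicit Arguments.
Unset Strict Implicit.
Unset Printing Implicit Defensive.
Import Order.TTheory GRing.Theory Num.Theory.
Import numFieldNormedType.Exports.
Local Open Scope classical_set_scope.
Local Open Scope ring_scope.

(** Why the formula holds.

    The supremum is at most [s(A)]. If [x >= 0] is nonzero and all its quotients
    are at least [c], then [A x >= c x], because [F] determines positivity and
    because [f (A x) >= 0] whenever [f x = 0] (the orbit of [x] is positive, see
    [positive_functional_generator]). If [c] exceeded [s(A)], then the resolvent
    [J] of [A] at [c] would be positive and [- x = J (A x - c x) >= 0] would give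
    [x = 0] ([subeigenvector_zero]). The resolvent is positive on the whole
    interval to the right of the real spectrum: positivity for large [mu] comes
    from the semigroup and moves to the left through Neumann series
    ([resolvent_positive]).

    The supremum is at least [s(A)]. For every [c < s(A)] there is a positive
    eigenvector with an eigenvalue [rho >= c] ([dominant_eigenvector]), and all
    of its quotients are [rho]. To find it, take a spectral point whose real part
    exceeds [c] and the essential spectral bound, and move to the right along its
    horizontal line to the last spectral point [alpha + i eta]. Near such a point
    the resolvents blow up on some vector [g] in the cone, and after
    normalisation they cluster at an eigenvector
    ([singular_resolvent_cluster]); this rests on the open mapping theorem and on
    compactness in the finite-dimensional kernel of a Fredholm operator. Now
    [|R(mu + i eta) x| <= R(mu) x] for [x >= 0] as long as [R] exists on
    [[mu, oo)]. So if [R(mu)] stayed bounded for [mu] near [alpha], the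
    eigenvector would be dominated by [0] and vanish. Therefore the real spectrum
    reaches at least [alpha] ([singular_real_above]). At its last point the
    resolvents are positive and cluster at a positive eigenvector
    ([real_singular_eigenvector]).

    The domination of resolvents is again a case of positivity. The pair of
    [R(mu + i eta)] and [R(mu)] is the resolvent at [mu] of a single operator
    ([block]) on the real Banach space [X * X * X]; its semigroup preserves the
    closed cone of all [(u, v, y)] such that [y] dominates the real part of every
    rotation of [u + i v] ([modulus_cone]). Thus [resolvent_positive] applies in
    that space.

    The resolvent for large [mu] and its positivity are obtained as follows. For
    the rescaled semigroup [U], which is a strict contraction at time [1], the
    integral [I] of the orbits over the unit
    interval, a limit of Riemann sums, satisfies [B I = U 1 - 1] for the
    generator [B], and [1 - U 1] is inverted by a Neumann series
    ([generator_resolvent0]). *)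

(** * Bounded linear maps, products and Neumann series *)

Section LinearMaps.
Variables (R : pzRingType) (V W : lmodType R) (f : V -> W).
Hypothesis lf : linear f.

Let pack_linear : {linear V -> W} :=
  HB.pack f (GRing.isLinear.Build _ _ _ _ _ lf).

Lemma lin0 : f 0 = 0. Proof. exact: (linear0 pack_linear). Qed.
Lemma linD x y : f (x + y) = f x + f y.
Proof. exact: (linearD pack_linear). Qed.
Lemma linB x y : f (x - y) = f x - f y.
Proof. exact: (linearB pack_linear). Qed.
Lemma linZ a x : f (a *: x) = a *: f x.
Proof. exact: (linearZ_LR pack_linear). Qed.
Lemma lin_sum n (g : 'I_n -> V) : f (\sum_(i < n) g i) = \sum_(i < n) f (g i).
Proof. exact: (linear_sum pack_linear). Qed.

End LinearMaps.

Section BoundedMaps.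
Variables (R : realType).
Implicit Types V W : normedModType R.

Definition bounded_op V W (f : V -> W) :=
  exists2 M : R, 0 < M & forall x, `|f x| <= M * `|x|.

Lemma bounded_opW V W (f : V -> W) (M : R) :
  (forall x, `|f x| <= M * `|x|) -> bounded_op f.
Proof.
move=> fM; exists (`|M| + 1) => [|x]; first by rewrite ltr_wpDl.
apply: le_trans (fM x) _; rewrite ler_wpM2r//.
by rewrite (le_trans (ler_norm M))// lerDl.
Qed.

Lemma linear_bounded_cont V W (f : V -> W) :
  linear f -> bounded_op f -> continuous f.
Proof.
move=> lf [M M0 fM] x; apply/cvgrPdist_le => e e0; near=> z.
rewrite -linB// (le_trans (fM _))// -ler_pdivlMl//.
near: z; apply: cvgr_dist_le => //.
by rewrite mulr_gt0 ?invr_gt0.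
Unshelve. all: by end_near. Qed.

Lemma linear_cont_bounded V W (f : V -> W) :
  linear f -> continuous f -> bounded_op f.
Proof.
move=> lf cf; pose g : {linear V -> W} :=
  HB.pack f (GRing.isLinear.Build _ _ _ _ _ lf).
have /linear_boundedP/pinfty_ex_gt0[M M0 gM] : bounded_near g (nbhs (0 : V)).
  by apply/linear_bounded_continuous.
by exists M.
Qed.

Lemma continuous_cvg_at V W (f : V -> W) T (F : set_system T) {FF : Filter F}
    (g : T -> V) (x : V) :
  continuous f -> g t @[t --> F] --> x -> f (g t) @[t --> F] --> f x.
Proof. by move=> cf gx; apply: cvg_comp gx _; exact: cf. Qed.

Lemma cvg_near_eq V T (F : set_system T) {FF : Filter F} (f g : T -> V) (l : V) :
  g t @[t --> F] --> l -> (\forall t \near F, f t = g t) ->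
  f t @[t --> F] --> l.
Proof.
by move=> gl fg; apply: cvg_trans gl; apply: near_eq_cvg; apply: filterS fg.
Qed.

Lemma norm_cvg_unique V T (F : set_system T) {FF : ProperFilter F}
    (g : T -> V) (x y : V) :
  g t @[t --> F] --> x -> g t @[t --> F] --> y -> x = y.
Proof. exact: (cvg_unique (@norm_hausdorff _ V)). Qed.

End BoundedMaps.

HB.saturate prod.

Section ProductComplete.
Variables (R : realType) (V W : completeNormedModType R).

Lemma prod_cauchy_cvg (F : set_system (V * W)%type) :
  ProperFilter F -> cauchy F -> cvg F.
Proof.
move=> FF Fc.
have cproj (U : completeNormedModType R) (p : V * W -> U) :
    (forall x y : V * W, `|p x - p y| <= `|x - y|) -> cvg (p @ F).
  move=> pP; apply: cauchy_cvg; apply: cauchy_exP => e e0.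
  have [x Fx] := (cauchyP F).1 Fc e e0.
  exists (p x); apply: (@filterS _ F _ (ball x e)) => // y /=.
  by rewrite -!ball_normE /=; apply: le_lt_trans.
have /cvg_ex[/= a Fa] : cvg (fst @ F).
  by apply: cproj => x y; rewrite prod_normE le_max lexx.
have /cvg_ex[/= b Fb] : cvg (snd @ F).
  by apply: cproj => x y; rewrite prod_normE le_max lexx orbT.
apply/cvg_ex; exists (a, b).
move=> A /(cvg_pair Fa Fb) FA.
by apply: (@filterS _ F _ _ _ _ FA) => -[].
Qed.

HB.instance Definition _ :=
  Uniform_isComplete.Build (V * W)%type prod_cauchy_cvg.

End ProductComplete.

Section Neumann.
Variables (R : realType) (V : completeNormedModType R).

(** Looking for the fixed point of [y |-> x + L y] inside an invariant closed
    set [K] is what shows that Neumann series preserve closed cones, without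
    summing them. *)
Lemma contraction_solution (L : V -> V) (q : R) (K : set V) (x : V) :
  linear L -> 0 <= q -> q < 1 -> (forall x, `|L x| <= q * `|x|) ->
  closed K -> K !=set0 -> (forall y, K y -> K (x + L y)) ->
  exists2 y, K y & y = x + L y.
Proof.
move=> lL q0 q1 Lq Kcl Kne Kx.
pose f := fun y => x + L y.
have fK : set_fun K K f by move=> y Ky; exact: Kx.
pose g : {fun K >-> K} := HB.pack f (isFun.Build _ _ _ _ f fK).
apply: (@banach_fixed_point R V K g) => //.
exists (NngNum q0); split => //= -[y z] /= _.
by rewrite /f opprD addrACA subrr add0r -linB.
Qed.

(** [1 - L] is invertible when [L] is a strict contraction; the inverse is the
    fixed point of [y |-> x + L y] as a function of [x]. *)
Lemma neumann (L : V -> V) (q : R) :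
  linear L -> 0 <= q -> q < 1 -> (forall x, `|L x| <= q * `|x|) ->
  exists N : V -> V, [/\ linear N /\ bounded_op N,
    forall x, N x - L (N x) = x, forall x, N (x - L x) = x &
    forall K : set V, closed K -> K 0 -> (forall x y, K x -> K y -> K (x + y)) ->
      (forall x, K x -> K (L x)) -> forall x, K x -> K (N x)].
Proof.
move=> lL q0 q1 Lq.
have uniq y z : y - L y = z - L z -> y = z.
  move=> /eqP; rewrite -subr_eq0 opprD addrACA -opprD -linB// subr_eq0.
  move=> /eqP yz; apply/eqP; rewrite -subr_eq0 -normr_eq0.
  have := Lq (y - z); rewrite -yz -subr_ge0 -{2}(mul1r `|_|) -mulrBl.
  by rewrite nmulr_rge0 ?subr_lt0// normr_le0 normr_eq0.
have solve x : exists y, y = x + L y.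
  have [||y _ yE] := @contraction_solution L q setT x lL q0 q1 Lq closedT.
  - by exists 0.
  - by [].
  by exists y.
pose N x := sval (cid (solve x)).
have NE x : N x - L (N x) = x.
  by rewrite /N; case: cid => y /= {1}->; rewrite addrK.
have Nunique y : N (y - L y) = y by apply: uniq; rewrite NE.
have NL : linear N.
  move=> a x y; apply: uniq.
  by rewrite lL opprD addrACA -scalerBr !NE.
exists N; split => //.
- split => //; apply: (@bounded_opW _ _ _ _ (1 - q)^-1) => x.
  rewrite ler_pdivlMl ?subr_gt0// mulrBl mul1r lerBlDr.
  rewrite -{1}(subrK (L (N x)) (N x)) {1}NE (le_trans (ler_normD _ _))//.
  by rewrite lerD2l.
- move=> K Kcl K0 KD KL x Kx.
  have [||y Ky yE] := @contraction_solution L q K x lL q0 q1 Lq Kcl.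
  + by exists 0.
  + by move=> z Kz; apply: KD => //; exact: KL.
  suff -> : N x = y by [].
  by apply: uniq; rewrite NE {1}yE addrK.
Qed.

End Neumann.

(** * Resolvents and the continuation of their positivity *)

Section Resolvents.
Variables (R : realType) (V : normedModType R).
Implicit Types (A : operator V) (J : V -> V) (K : set V).

Definition linear_op A := dom A 0 /\ forall a x y, dom A x -> dom A y ->
  dom A (a *: x + y) /\ A (a *: x + y) = a *: A x + A y.

Lemma linear_op0 A : linear_op A -> A 0 = 0.
Proof.
move=> [A0 Al]; have [_] := Al (-1) _ _ A0 A0.
by rewrite scaleN1r addNr scaleN1r addNr.
Qed.

Lemma linear_opZ A (a : R) x : linear_op A -> dom A x ->
  dom A (a *: x) /\ A (a *: x) = a *: A x.
Proof.
move=> lA dx; have [A0 Al] := lA; have := Al a _ _ dx A0.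
by rewrite !addr0 (linear_op0 lA) addr0.
Qed.

Lemma linear_opB A x y : linear_op A -> dom A x -> dom A y ->
  dom A (x - y) /\ A (x - y) = A x - A y.
Proof.
move=> [A0 Al] dx dy; have := Al (-1) _ _ dy dx.
by rewrite !scaleN1r ![- _ + _]addrC.
Qed.

Definition is_resolvent A (mu : R) J :=
  [/\ forall y, dom A (J y) /\ mu *: J y - A (J y) = y,
      forall x, dom A x -> J (mu *: x - A x) = x & bounded_op J].

Definition closed_cone K := [/\ closed K, K 0,
  forall x y, K x -> K y -> K (x + y) &
  forall (a : R) x, 0 <= a -> K x -> K (a *: x)].

Definition preserves K J := forall x, K x -> K (J x).

Lemma resolvent_unique A mu J J' :
  is_resolvent A mu J -> is_resolvent A mu J' -> J =1 J'.
Proof. by move=> [_ JK _] [J'P _ _] y; have [? {1}<-] := J'P y; rewrite JK. Qed.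

Lemma resolvent_linear A mu J : linear_op A -> is_resolvent A mu J -> linear J.
Proof.
move=> [_ AL] [JP JK _] a x y.
have [dx xE] := JP x; have [dy yE] := JP y.
have [dxy AE] := AL a _ _ dx dy.
rewrite -[RHS]JK// AE; congr J.
rewrite scalerDr opprD addrACA -{1}xE -{1}yE scalerBr.
by congr (_ - _ + _); rewrite !scalerA mulrC.
Qed.

End Resolvents.

Section ResolventPositivity.
Variables (R : realType) (V : completeNormedModType R).
Implicit Types (A : operator V) (K : set V).

(** If [mu - A] has the inverse [J], then [mu - t - A = (1 - t J) (mu - A)] and
    [1 - t J] is inverted by a Neumann series. For [t >= 0] this series has
    nonnegative coefficients, so that positivity moves to the left. *)
Lemma resolvent_shift A mu J (M t : R) : linear_op A -> is_resolvent A mu J ->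
  (forall x, `|J x| <= M * `|x|) -> 0 <= M -> `|t| * M < 1 ->
  exists J', [/\ is_resolvent A (mu - t) J',
    forall x, `|J' x| <= M / (1 - `|t| * M) * `|x| &
    0 <= t -> forall K, closed_cone K -> preserves K J -> preserves K J'].
Proof.
move=> lA Jres JM M0 tM.
have lJ := resolvent_linear lA Jres.
have ltJ : linear (fun x => t *: J x).
  by move=> a x y; rewrite lJ scalerDr !scalerA mulrC.
have tJM x : `|t *: J x| <= `|t| * M * `|x|.
  by rewrite normrZ -mulrA ler_wpM2l.
have tM0 : 0 <= `|t| * M by rewrite mulr_ge0.
have [N [[lN _] NP NK Ncone]] := neumann ltJ tM0 tM tJM.
have [JP JK _] := Jres.
have NM x : `|N x| <= (1 - `|t| * M)^-1 * `|x|.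
  rewrite ler_pdivlMl ?subr_gt0// mulrBl mul1r lerBlDr.
  rewrite -{1}(subrK (t *: J (N x)) (N x)) {1}NP (le_trans (ler_normD _ _))//.
  by rewrite lerD2l.
have J'M x : `|J (N x)| <= M / (1 - `|t| * M) * `|x|.
  by rewrite (le_trans (JM _))// -mulrA ler_wpM2l.
exists (J \o N); split => //.
- split=> [y|x dx|].
  + have [dJ E] := JP (N y); split=> //=.
    by rewrite scalerBl addrAC E NP.
  + have E : (mu - t) *: x - A x =
        (mu *: x - A x) - t *: J (mu *: x - A x) by rewrite JK// scalerBl addrAC.
    by rewrite /= E NK JK.
  + exact: (bounded_opW J'M).
- move=> t0 K [Kcl K0 KD KZ] KJ x Kx /=; apply: (KJ).
  by apply: Ncone Kx => // y Ky; apply: KZ => //; exact: KJ.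
Qed.

(** The leftward moves of [resolvent_shift] have a length which depends only on
    the norm of the resolvent, hence is locally bounded from below: started at
    large [mu] they cannot accumulate before [a]. *)
Lemma resolvent_positive A K (a b : R) : linear_op A -> closed_cone K ->
  (forall mu, a <= mu -> exists J, is_resolvent A mu J) ->
  (forall mu J, b <= mu -> is_resolvent A mu J -> preserves K J) ->
  forall mu J, a <= mu -> is_resolvent A mu J -> preserves K J.
Proof.
move=> lA cK Aa Ab.
pose pos mu := forall J, is_resolvent A mu J -> preserves K J.
pose S : set R := [set mu | a <= mu /\ forall nu, mu <= nu -> pos nu].
suff Sa : S a by move=> mu J amu; exact: Sa.2.
have Smax : S (Num.max a b).
  split=> [|nu]; first by rewrite le_max lexx.
  by rewrite ge_max => /andP[_ bnu] J; exact: Ab.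
have Slb : lbound S a by move=> mu [].
have Sinf : has_inf S by split; [exists (Num.max a b) | exists a].
set m := inf S.
have am : a <= m by apply: lb_le_inf => //; exists (Num.max a b).
have [J Jres] := Aa m am.
have [_ _ [M M0 JM]] := Jres.
(* Resolvents within [d] of [m] have norm at most [4 / 3 * M], so one move to
   the left from a point of [S] just above [m] reaches [m - d]. *)
pose d := (4 * M)^-1.
have d0 : 0 < d by rewrite invr_gt0 mulr_gt0.
have dM : d * M = 4^-1 by rewrite /d invfM -mulrA mulVf ?mulr1// gt_eqF.
have [s [as_ Ss] sm] := inf_adherent d0 Sinf.
have ms : m <= s by apply: ge_inf => //; exists a.
have t1 : `|m - s| * M <= 4^-1.
  rewrite -dM ler_pM2r// distrC ger0_norm ?subr_ge0//.
  by rewrite lerBlDl ltW.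
have t2 : `|m - s| * M < 1 by rewrite (le_lt_trans t1)// invf_lt1 ?ltr1n.
have [Js [Jsres JsM _]] := resolvent_shift lA Jres JM (ltW M0) t2.
rewrite opprB addrC subrK in Jsres.
have JsM2 x : `|Js x| <= 4 / 3 * M * `|x|.
  apply: le_trans (JsM x) _; rewrite ler_wpM2r// ler_pdivrMr ?subr_gt0//.
  set r := `|m - s| * M in t1 *.
  have : 0 <= M * (4^-1 - r) by rewrite mulr_ge0 ?subr_ge0// ltW.
  by lra.
have step nu : m - d <= nu -> nu <= s -> pos nu.
  move=> mnu nus; have := @resolvent_shift A s Js (4 / 3 * M) (s - nu) lA Jsres JsM2.
  have s0 : 0 <= s - nu by rewrite subr_ge0.
  case=> [||J' [J'res _ J'K]].
  - by rewrite mulr_ge0// ltW.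
  - have : (s - nu) * M <= 2 * 4^-1.
      by rewrite -dM mulrA ler_pM2r//; move: sm; rewrite -/m; lra.
    by rewrite ger0_norm// mulrCA; lra.
  - rewrite opprB addrC subrK in J'res.
    move=> J2 J2res x Kx; rewrite -(resolvent_unique J'res J2res).
    by apply: J'K Kx => //; exact: (Ss s).
have Sc : S (Num.max a (m - d)).
  split=> [|nu]; first by rewrite le_max lexx.
  rewrite ge_max => /andP[_ mnu]; have [nus|/ltW snu] := leP nu s.
    exact: step.
  exact: Ss.
suff <- : Num.max a (m - d) = a by [].
have : m <= Num.max a (m - d) by apply: ge_inf => //; exists a.
rewrite le_max => /orP[ma|]; last by move=> H; lra.
by apply/max_idPl; lra.
Qed.

End ResolventPositivity.

(** * Local boundedness of strongly continuous semigroups *)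

Section Semigroups.
Variables (R : realType) (V : completeNormedModType R).
Implicit Types (U T : R -> V -> V) (B : operator V).

Lemma C0_near0 T (x : V) (e : R) : C0_semigroup T -> 0 < e ->
  exists2 d : R, 0 < d & forall t, 0 <= t -> t < d -> `|T t x - x| <= e.
Proof.
move=> [_ T0 _ Tc] e0.
have /cvgrPdist_le/(_ e e0)[d d0 dP] := Tc x.
exists d => // t; rewrite le_eqVlt => /predU1P[<- _|t0 td].
  by rewrite T0 subrr normr0 ltW.
by rewrite distrC; apply: dP => //=; rewrite sub0r normrN gtr0_norm.
Qed.

(** Otherwise there are times [s k] tending to [0] whose operators are
    unbounded in norm; yet they are pointwise bounded since [T t x] tends to
    [x], against the Banach-Steinhaus theorem. *)
Lemma C0_bounded_near0 T : C0_semigroup T ->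
  exists2 d : R, 0 < d &
    exists2 M : R, 1 <= M & forall t, 0 <= t -> t <= d ->
      forall x, `|T t x| <= M * `|x|.
Proof.
move=> CT; have [Tl T0 TD Tc] := CT; apply: contrapT => H.
have bad (k : nat) : exists tx : R * V,
    [/\ 0 <= tx.1, tx.1 <= k.+1%:R^-1 & k.+1%:R * `|tx.2| < `|T tx.1 tx.2|].
  apply: contrapT => Hk; apply: H.
  exists k.+1%:R^-1; first by rewrite invr_gt0.
  exists k.+1%:R; first by rewrite ler1n.
  move=> t t0 tk x; rewrite leNgt; apply/negP => lt.
  by apply: Hk; exists (t, x).
pose s k := sval (cid (bad k)).
have sP k : [/\ 0 <= (s k).1, (s k).1 <= k.+1%:R^-1 &
    k.+1%:R * `|(s k).2| < `|T (s k).1 (s k).2|] by rewrite /s; case: cid.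
pose F := [set T (s k).1 | k in [set: nat]].
have [|x|M FM] := @Banach_Steinhauss R V V F _ _ 1.
- move=> _ [k _ <-]; have [s0 _ _] := sP k.
  have [lT cT] := Tl _ s0; split=> // r.
  have [M M0 TM] := linear_cont_bounded lT cT.
  by exists (M * r) => x xr; rewrite (le_trans (TM x))// ler_pM2l.
- have [d d0 dP] := C0_near0 x CT ltr01.
  pose K := Num.truncn d^-1.
  exists (`|x| + 1 + \sum_(k < K.+1) `|T (s k).1 x|) => _ [k _ <-].
  have [s0 sk _] := sP k.
  have [kK|Kk] := ltnP k K.+1.
    rewrite (bigD1 (Ordinal kK))//= addrCA lerDl addr_ge0 ?addr_ge0//.
    exact: sumr_ge0.
  rewrite -[leLHS]addr0 lerD ?sumr_ge0//.
  rewrite -lerBlDl; apply: le_trans (lerB_dist _ _) _; apply: dP => //.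
  apply: le_lt_trans sk _; rewrite -[ltRHS]invrK ltf_pV2 ?posrE ?invr_gt0//.
  apply: (@lt_le_trans _ _ K.+1%:R); first exact: truncnS_gt.
  by rewrite ler_nat ltnW.
- pose k := Num.truncn M.
  have [s0 _ sM] := sP k; have [lT _] := Tl _ s0.
  set x := (s k).2 in sM.
  have x0 : 0 < `|x|.
    by rewrite lt_neqAle normr_ge0 andbT eq_sym; apply: contraTneq sM => /eqP;
      rewrite normr_eq0 => /eqP ->; rewrite (lin0 lT) normr0 mulr0 ltxx.
  have : `|T (s k).1 (`|x|^-1 *: x)| <= M.
    apply: FM; first by exists k.
    by rewrite normfZV// -normr_gt0.
  rewrite (linZ lT) normrZ normfV normr_id ler_pdivrMl// mulrC leNgt.
  move=> /negP; apply; apply: le_lt_trans sM.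
  by rewrite ler_pM2r// ltW// truncnS_gt.
Qed.

Lemma C0_bounded T : C0_semigroup T ->
  exists2 M : R, 1 <= M & forall t, 0 <= t -> t <= 1 ->
      forall x, `|T t x| <= M * `|x|.
Proof.
move=> CT; have [d d0 [M M1 TM]] := C0_bounded_near0 CT.
have [_ _ TD _] := CT.
have Mn n t : 0 <= t -> t <= n%:R * d -> forall x, `|T t x| <= M ^+ n.+1 * `|x|.
  elim: n t => [|n IH] t t0 tn x.
    rewrite expr1; apply: TM => //; apply: le_trans tn _.
    by rewrite mul0r ltW.
  have [td|dt] := leP t d.
    apply: le_trans (TM t t0 td x) _; rewrite ler_wpM2r// ler_eXnr//.
  rewrite -(subrKC d t) TD//=; first last.
  - by rewrite subr_ge0 ltW.
  - exact: ltW.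
  rewrite exprS -mulrA.
  apply: le_trans (TM d (ltW d0) (lexx _) _) _; rewrite ler_pM2l; last lra.
  apply: IH; first by rewrite subr_ge0 ltW.
  by move: tn; rewrite -natr1 mulrDl mul1r lerBlDr.
exists (M ^+ (Num.truncn d^-1).+2) => [|t t0 t1 x]; first by rewrite exprn_ege1.
apply: Mn => //; apply: le_trans t1 _.
by rewrite -ler_pdivrMr// mul1r ltW// truncnS_gt.
Qed.

End Semigroups.

(** * The integral of an orbit over the unit interval *)

Section OrbitMean.
Variables (R : realType) (V : completeNormedModType R) (U : R -> V -> V).
Hypothesis CU : C0_semigroup U.

Let Ulin t : 0 <= t -> linear (U t).
Proof. by case: CU => /(_ t) H _ _ _ /H[]. Qed.

Let Ucont t : 0 <= t -> continuous (U t).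
Proof. by case: CU => /(_ t) H _ _ _ /H[]. Qed.

Let UD s t x : 0 <= s -> 0 <= t -> U (s + t) x = U s (U t x).
Proof. by case: CU => _ _ H _ s0 t0; rewrite H. Qed.

Definition orbit_sum n (h : R) x := \sum_(i < n) U (i%:R * h) x.

Lemma orbit_sumD a b h x : 0 <= h ->
  orbit_sum (a + b) h x = orbit_sum a h x + U (a%:R * h) (orbit_sum b h x).
Proof.
move=> h0; rewrite /orbit_sum big_split_ord/=; congr (_ + _).
rewrite lin_sum; last by apply: Ulin; rewrite mulr_ge0.
by apply: eq_bigr => i _; rewrite natrD mulrDl UD// mulr_ge0.
Qed.

Lemma orbit_sumM n m h x : 0 <= h ->
  orbit_sum (n * m) h x = \sum_(i < n) U (i%:R * (m%:R * h)) (orbit_sum m h x).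
Proof.
move=> h0; elim: n => [|n IH]; first by rewrite mul0n /orbit_sum !big_ord0.
by rewrite mulSnr orbit_sumD// IH big_ord_recr/= natrM mulrA.
Qed.

Lemma orbit_sum_dist n h x e : 0 <= h ->
  (forall t, 0 <= t -> t <= n%:R * h -> `|U t x - x| <= e) ->
  `|orbit_sum n h x - n%:R *: x| <= n%:R * e.
Proof.
move=> h0 He.
have -> : n%:R *: x = \sum_(i < n) x.
  by rewrite sumr_const card_ord scaler_nat.
rewrite -sumrB (le_trans (ler_norm_sum _ _ _))//.
have -> : n%:R * e = \sum_(i < n) e by rewrite sumr_const card_ord mulr_natl.
apply: ler_sum => i _; apply: He; first by rewrite mulr_ge0.
by rewrite ler_wpM2r// ler_nat ltnW.
Qed.

(** A Riemann sum for the integral of [U s x] over [0 <= s <= 1]. *)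
Definition orbit_mean n x := n%:R^-1 *: orbit_sum n n%:R^-1 x.

Variable M : R.
Hypothesis M1 : 1 <= M.
Hypothesis UM : forall t, 0 <= t -> t <= 1 -> forall x, `|U t x| <= M * `|x|.

Let M0 : 0 < M. Proof. exact: lt_le_trans M1. Qed.

(** Refining the subdivision moves every node by at most [1 / n], and
    [U (s + t) x - U s x = U s (U t x - x)]; so only the behaviour of the orbit
    near time [0] matters for the convergence of the Riemann sums. *)
Lemma orbit_mean_refine n m x e : (0 < n)%N -> (0 < m)%N ->
  (forall t, 0 <= t -> t <= n%:R^-1 -> `|U t x - x| <= e) ->
  `|orbit_mean (n * m) x - orbit_mean n x| <= M * e.
Proof.
move=> n0 m0 He.
have nR : n%:R != 0 :> R by rewrite pnatr_eq0 -lt0n.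
have mR : m%:R != 0 :> R by rewrite pnatr_eq0 -lt0n.
set h := (n * m)%:R^-1 : R.
have h0 : 0 <= h by rewrite invr_ge0.
have mh : m%:R * h = n%:R^-1 by rewrite /h natrM invfM mulrCA mulfV// mulr1.
have E : orbit_mean (n * m) x - orbit_mean n x =
    h *: \sum_(i < n) U (i%:R * n%:R^-1) (orbit_sum m h x - m%:R *: x).
  rewrite /orbit_mean -/h orbit_sumM// mh.
  have -> : n%:R^-1 = h * m%:R :> R by rewrite mulrC mh.
  rewrite -scalerA -scalerBr; congr (_ *: _).
  rewrite mulrC mh scaler_sumr -sumrB; apply: eq_bigr => i _.
  have i0 : 0 <= i%:R / n%:R :> R by rewrite divr_ge0.
  by rewrite (linB (Ulin i0)) (linZ (Ulin i0)).
rewrite E normrZ ger0_norm//.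
apply: (@le_trans _ _ (h * \sum_(i < n) (M * (m%:R * e)))).
  rewrite ler_wpM2l// (le_trans (ler_norm_sum _ _ _))//.
  apply: ler_sum => i _; apply: le_trans (UM _ _ _) _.
  - by rewrite divr_ge0.
  - by rewrite ler_pdivrMr ?ltr0n// mul1r ler_nat ltnW.
  - by rewrite ler_pM2l//; apply: orbit_sum_dist => //; rewrite mh.
rewrite sumr_const card_ord -[_ *+ n]mulr_natl.
have -> : h * (n%:R * (M * (m%:R * e))) = (m%:R * h) * n%:R * (M * e) by ring.
by rewrite mh mulVf// mul1r.
Qed.

Lemma orbit_mean_cvg x : cvg (orbit_mean n.+1 x @[n --> \oo]).
Proof.
apply: cauchy_cvg; apply: cauchy_exP => e e0.
have e'0 : 0 < e / (4 * M) by rewrite divr_gt0// mulr_gt0.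
have [d d0 dP] := C0_near0 x CU e'0.
pose N := Num.truncn d^-1.
have small n : (N <= n)%N -> forall m,
    `|orbit_mean (n.+1 * m.+1) x - orbit_mean n.+1 x| <= e / 4.
  move=> Nn m.
  have -> : e / 4 = M * (e / (4 * M)).
    by field; rewrite gt_eqF.
  apply: orbit_mean_refine => // t t0 tn; apply: dP => //.
  apply: le_lt_trans tn _; rewrite -[ltRHS]invrK ltf_pV2 ?posrE ?invr_gt0//.
  by rewrite -truncn_le_nat.
(* The means of orders [N.+1] and [n.+1] are both compared to the one of order
   [N.+1 * n.+1]. *)
exists (orbit_mean N.+1 x); exists N => // n /= Nn.
rewrite -ball_normE /=.
rewrite -(subrK (orbit_mean (N.+1 * n.+1) x) (orbit_mean N.+1 x)) -addrA.
rewrite (le_lt_trans (ler_normD _ _))// distrC.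
rewrite (@le_lt_trans _ _ (e / 4 + e / 4))//; last lra.
apply: lerD; first exact: small.
by rewrite mulnC; apply: small.
Qed.

(** The integral of [U s x] over [0 <= s <= 1]. *)
Definition orbit_int x := lim (orbit_mean n.+1 x @[n --> \oo]).

Let orbit_intP x : orbit_mean n.+1 x @[n --> \oo] --> orbit_int x.
Proof. exact: orbit_mean_cvg. Qed.

Lemma orbit_mean_linear n : linear (orbit_mean n).
Proof.
move=> a x y; rewrite /orbit_mean /orbit_sum.
under eq_bigr do rewrite Ulin ?divr_ge0//.
by rewrite big_split/= -scaler_sumr scalerDr !scalerA mulrC.
Qed.

Lemma orbit_mean_bound n x : `|orbit_mean n x| <= M * `|x|.
Proof.
case: n => [|n].
  by rewrite /orbit_mean invr0 scale0r normr0 mulr_ge0// ltW.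
rewrite normrZ gtr0_norm ?invr_gt0// ler_pdivrMl//.
rewrite (le_trans (ler_norm_sum _ _ _))//.
have -> : n.+1%:R * (M * `|x|) = \sum_(i < n.+1) (M * `|x|).
  by rewrite sumr_const card_ord mulr_natl.
apply: ler_sum => i _; apply: UM; first by rewrite divr_ge0.
by rewrite ler_pdivrMr// mul1r ler_nat ltnW.
Qed.

Lemma orbit_int_linear : linear orbit_int.
Proof.
move=> a x y.
apply: norm_cvg_unique (orbit_intP (x := a *: x + y)) _.
under eq_fun do rewrite orbit_mean_linear.
by apply: cvgD => //; exact: cvgZl_tmp.
Qed.

Lemma orbit_int_bound x : `|orbit_int x| <= M * `|x|.
Proof.
have /cvg_norm := orbit_intP (x := x).
move/cvgr_to_le; apply; apply: nearW => n; exact: orbit_mean_bound.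
Qed.

Lemma orbit_int_commute (L : V -> V) : linear L -> continuous L ->
  (forall t x, 0 <= t -> L (U t x) = U t (L x)) ->
  forall x, L (orbit_int x) = orbit_int (L x).
Proof.
move=> lL cL LU x.
apply: norm_cvg_unique (orbit_intP (x := L x)).
suff -> : (fun n => orbit_mean n.+1 (L x)) = (fun n => L (orbit_mean n.+1 x)).
  exact: continuous_cvg_at.
apply/funext => n; rewrite /orbit_mean /orbit_sum (linZ lL) (lin_sum lL).
by congr (_ *: _); apply: eq_bigr => i _; rewrite LU// divr_ge0.
Qed.

Lemma orbit_int_preserves K : closed_cone K ->
  (forall t, 0 <= t -> preserves K (U t)) -> preserves K orbit_int.
Proof.
move=> [Kcl K0 KD KZ] KU x Kx.
apply: closed_cvg (orbit_intP (x := x)) => //; apply: nearW => n.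
apply: KZ; first by rewrite invr_ge0.
by apply: big_ind => // i _; apply: KU => //; rewrite divr_ge0.
Qed.

(** Shifting the sum by [m] nodes only affects its first and last [m] terms. *)
Lemma orbit_mean_shift n m x : (0 < n)%N ->
  U (m%:R / n%:R) (orbit_mean n x) - orbit_mean n x =
  U 1 (n%:R^-1 *: orbit_sum m n%:R^-1 x) - n%:R^-1 *: orbit_sum m n%:R^-1 x.
Proof.
move=> n0; have nR : n%:R != 0 :> R by rewrite pnatr_eq0 -lt0n.
have ni : 0 <= n%:R^-1 :> R by rewrite invr_ge0.
have mn : 0 <= m%:R / n%:R :> R by rewrite divr_ge0.
rewrite /orbit_mean (linZ (Ulin mn)) (linZ (Ulin ler01)) -!scalerBr.
congr (_ *: _).
have E : orbit_sum m n%:R^-1 x + U (m%:R / n%:R) (orbit_sum n n%:R^-1 x) =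
    orbit_sum n n%:R^-1 x + U 1 (orbit_sum m n%:R^-1 x).
  by rewrite -orbit_sumD// addnC orbit_sumD// mulfV.
apply/eqP; rewrite subr_eq addrAC eq_sym subr_eq; apply/eqP.
by rewrite addrC -E addrC.
Qed.

(** [U h - 1] applied to the integral over the unit interval is [U 1 - 1]
    applied to the integral over [0 <= s <= h], and the latter is close to
    [h *: x]. *)
Lemma orbit_int_shift x h e : 0 < h -> h <= 1 -> 0 <= e ->
  (forall t, 0 <= t -> t <= h -> `|U t x - x| <= e) ->
  `|U h (orbit_int x) - orbit_int x - h *: (U 1 x - x)| <= (M + 1) * (h * e).
Proof.
move=> h0 h1 e0 He; have hge0 := ltW h0.
have cv : (U h (orbit_mean n.+1 x) - orbit_mean n.+1 x - h *: (U 1 x - x)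
    @[n --> \oo] --> U h (orbit_int x) - orbit_int x - h *: (U 1 x - x)).
  apply: cvgB; last exact: cvg_cst.
  apply: cvgB => //; apply: continuous_cvg_at => //; exact: Ucont.
apply/ler_addgt0Pr => eta eta0.
move/cvg_norm/cvgr_to_le: cv; apply.
pose eta1 := eta / (2 * (M * M)).
have eta10 : 0 < eta1 by rewrite divr_gt0// !mulr_gt0.
have [d d0 dP] := C0_near0 x CU eta10.
near=> n.
have nd : n.+1%:R^-1 < d.
  rewrite -[ltRHS]invrK ltf_pV2 ?posrE ?invr_gt0//.
  rewrite -truncn_le_nat; near: n; exact: nbhs_infty_ge.
have nx : (M + 1) * (n.+1%:R^-1 * `|x|) <= eta / 2.
  rewrite mulrCA ler_pdivrMl// -ler_pdivrMr ?divr_gt0// ltW//.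
  rewrite -truncn_le_nat; near: n; exact: nbhs_infty_ge.
(* [h] is rounded down to [m / n.+1], where [orbit_mean_shift] applies; the
   rest [r] disappears when [n] grows. *)
pose m := Num.truncn (h * n.+1%:R).
have /andP[m1 m2] : m%:R <= h * n.+1%:R < m.+1%:R by rewrite truncn_itv// mulr_ge0.
have mn0 : 0 <= m%:R / n.+1%:R :> R by rewrite divr_ge0.
have mnh : m%:R / n.+1%:R <= h by rewrite ler_pdivrMr.
pose r := h - m%:R / n.+1%:R.
have r0 : 0 <= r by rewrite subr_ge0.
have rn : r <= n.+1%:R^-1.
  rewrite /r lerBlDr -{1}(mul1r n.+1%:R^-1) -mulrDl ler_pdivlMr//.
  by rewrite addrC natr1 ltW.
pose z := n.+1%:R^-1 *: orbit_sum m n.+1%:R^-1 x.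
have E : U h (orbit_mean n.+1 x) - orbit_mean n.+1 x - h *: (U 1 x - x) =
    U (m%:R / n.+1%:R) (orbit_mean n.+1 (U r x - x)) +
    (U 1 (z - h *: x) - (z - h *: x)).
  have -> : U h (orbit_mean n.+1 x) =
      U (m%:R / n.+1%:R) (orbit_mean n.+1 (U r x)).
    have -> : orbit_mean n.+1 (U r x) = U r (orbit_mean n.+1 x).
      rewrite /orbit_mean /orbit_sum (linZ (Ulin r0)) (lin_sum (Ulin r0)).
      congr (_ *: _); apply: eq_bigr => i _.
      by rewrite -!UD ?divr_ge0// addrC.
    by rewrite -UD// /r subrKC.
  rewrite (linB (@orbit_mean_linear _)) (linB (Ulin mn0)).
  rewrite (linB (Ulin ler01)) (linZ (Ulin ler01) h).
  have := @orbit_mean_shift n.+1 m x isT; rewrite -/z => S.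
  have -> : U 1 z - h *: U 1 x - (z - h *: x) =
      (U 1 z - z) - h *: (U 1 x - x).
    by rewrite scalerBr !opprB [h *: x - z]addrC addrACA [- (h *: _) + _]addrC.
  rewrite -S addrA; congr (_ - _).
  by rewrite addrA subrK.
rewrite E (le_trans (ler_normD _ _))//.
have zh : `|z - h *: x| <= h * e + n.+1%:R^-1 * `|x|.
  rewrite -(subrK ((m%:R / n.+1%:R) *: x) z) -addrA (le_trans (ler_normD _ _))//.
  apply: lerD.
    rewrite /z mulrC -scalerA -scalerBr normrZ gtr0_norm ?invr_gt0//.
    rewrite ler_pdivrMl//; apply: le_trans (_ : m%:R * e <= _).
      apply: orbit_sum_dist; first by rewrite invr_ge0.
      by move=> t t0 tm; apply: He => //; exact: le_trans mnh.
    by rewrite mulrA ler_wpM2r// mulrC.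
  rewrite -scalerBl normrZ distrC ger0_norm//.
  by rewrite ler_wpM2r.
have H1 : `|U (m%:R / n.+1%:R) (orbit_mean n.+1 (U r x - x))| <= eta / 2.
  apply: le_trans (UM mn0 _ _) _; first exact: le_trans h1.
  have -> : eta / 2 = M * (M * eta1).
    rewrite /eta1; field; by rewrite gt_eqF.
  rewrite ler_pM2l// (le_trans (orbit_mean_bound _ _))// ler_pM2l//.
  by apply: dP => //; exact: le_lt_trans nd.
have H2 : `|U 1 (z - h *: x) - (z - h *: x)| <= (M + 1) * `|z - h *: x|.
  rewrite (le_trans (ler_normB _ _))// mulrDl mul1r lerD2r.
  exact: UM.
have M10 : 0 < M + 1 by rewrite addr_gt0.
rewrite [eta]splitr addrA addrC lerD//; apply: le_trans H2 _.
apply: (@le_trans _ _ ((M + 1) * (h * e + n.+1%:R^-1 * `|x|))).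
  by rewrite ler_pM2l.
by rewrite mulrDr lerD2l.
Unshelve. all: by end_near. Qed.

Lemma orbit_int_derive x :
  h^-1 *: (U h (orbit_int x) - orbit_int x) @[h --> 0^'+] --> U 1 x - x.
Proof.
apply/cvgrPdist_le => e e0.
have M10 : 0 < M + 1 by rewrite addr_gt0.
have e'0 : 0 < e / (M + 1) by rewrite divr_gt0.
have [d d0 dP] := C0_near0 x CU e'0.
near=> h.
have h0 : 0 < h by near: h; exact: nbhs_right_gt.
have h1 : h <= 1 by near: h; apply: nbhs_right_le.
have hd : h < d by near: h; apply: nbhs_right_lt.
have hn : h != 0 by rewrite gt_eqF.
set D := U h _ - _.
have -> : h^-1 *: D = h^-1 *: (D - h *: (U 1 x - x)) + (U 1 x - x).
  by rewrite (scalerBr h^-1 D) scalerA mulVf// scale1r subrK.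
rewrite opprD addrCA subrr addr0 normrN normrZ gtr0_norm ?invr_gt0// ler_pdivrMl//.
have -> : h * e = (M + 1) * (h * (e / (M + 1))) by field; rewrite gt_eqF.
apply: orbit_int_shift => //; first exact: ltW.
by move=> t t0 th; apply: dP => //; exact: le_lt_trans hd.
Unshelve. all: by end_near. Qed.

End OrbitMean.

(** * Generators, their resolvents and direct sums *)

Section Generators.
Variables (R : realType).

Lemma generator_linear (V : normedModType R) (T : R -> V -> V)
    (B : operator V) :
  C0_semigroup T -> is_generator T B -> linear_op B.
Proof.
move=> [Tl _ _ _] [Bd Bl]; split.
  apply/Bd; exists 0; apply: cvg_near_cst; near=> h.
  have h0 : 0 <= h by near: h; exact: nbhs_right_ge.
  by rewrite (lin0 (Tl _ h0).1) subrr scaler0.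
move=> a x y dx dy.
have lim : h^-1 *: (T h (a *: x + y) - (a *: x + y)) @[h --> 0^'+] -->
    a *: B x + B y.
  apply: cvg_near_eq (cvgD (cvgZl_tmp (k := a) (Bl x dx)) (Bl y dy)) _.
  near=> h => /=.
  have h0 : 0 <= h by near: h; exact: nbhs_right_ge.
  rewrite (Tl _ h0).1 opprD addrACA scalerDr -scalerBr.
  by rewrite !scalerA mulrC.
have d : dom B (a *: x + y) by apply/Bd; eexists; exact: lim.
by split => //; exact: norm_cvg_unique (Bl _ d) lim.
Unshelve. all: by end_near. Qed.

Lemma generator_commute (V : normedModType R) (T : R -> V -> V)
    (B : operator V) t x :
  C0_semigroup T -> is_generator T B -> 0 <= t -> dom B x ->
  dom B (T t x) /\ B (T t x) = T t (B x).
Proof.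
move=> [Tl _ TD _] [Bd Bl] t0 dx; have [lT cT] := Tl t t0.
have lim : h^-1 *: (T h (T t x) - T t x) @[h --> 0^'+] --> T t (B x).
  apply: (cvg_near_eq (continuous_cvg_at cT (Bl x dx))); near=> h => /=.
  have h0 : 0 <= h by near: h; exact: nbhs_right_ge.
  rewrite (linZ lT) (linB lT); congr (_ *: (_ - _)).
  by rewrite -[LHS]/((T h \o T t) x) -[RHS]/((T t \o T h) x) -!TD// addrC.
have d : dom B (T t x) by apply/Bd; eexists; exact: lim.
by split => //; exact: norm_cvg_unique (Bl _ d) lim.
Unshelve. all: by end_near. Qed.

(** If [I] is the integral of the orbits over the unit interval, then both
    [B I] and [I B] are [U 1 - 1]. Hence [I (1 - U 1)^-1] is inverse to [- B],
    and it preserves the closed invariant cones because both factors do. *)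
Lemma generator_resolvent0 (V : completeNormedModType R) (U : R -> V -> V)
    (B : operator V) (q : R) :
  C0_semigroup U -> is_generator U B ->
  0 <= q -> q < 1 -> (forall x, `|U 1 x| <= q * `|x|) ->
  exists J, is_resolvent B 0 J /\
    forall K, closed_cone K -> (forall t, 0 <= t -> preserves K (U t)) ->
    preserves K J.
Proof.
move=> CU [Bd Bl] q0 q1 Uq.
have [M M1 UM] := C0_bounded CU.
have M0 : 0 < M by exact: lt_le_trans M1.
have [Ul _ UD _] := CU.
have lU1 := (Ul 1 ler01).1.
have [N [[lN bN] NP NK Ncone]] := neumann lU1 q0 q1 Uq.
pose I := orbit_int U.
have lI : linear I := orbit_int_linear CU M1 UM.
have bI : bounded_op I := bounded_opW (orbit_int_bound CU M1 UM).
have cI : continuous I := linear_bounded_cont lI bI.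
have IU t x : 0 <= t -> I (U t x) = U t (I x).
  move=> t0; have [lt ct] := Ul t t0.
  rewrite /I (orbit_int_commute CU M1 UM lt ct)// => s y s0.
  by rewrite -[LHS]/((U t \o U s) y) -[RHS]/((U s \o U t) y) -!UD// addrC.
have dI y : dom B (I y) /\ B (I y) = U 1 y - y.
  have lim := orbit_int_derive CU M1 UM (x := y).
  have d : dom B (I y) by apply/Bd; eexists; exact: lim.
  by split => //; exact: norm_cvg_unique (Bl _ d) lim.
have IB x : dom B x -> I (B x) = U 1 x - x.
  move=> dx; apply: (norm_cvg_unique (continuous_cvg_at cI (Bl x dx))).
  apply: cvg_near_eq (orbit_int_derive CU M1 UM (x := x)) _; near=> h => /=.
  have h0 : 0 <= h by near: h; exact: nbhs_right_ge.
  by rewrite (linZ lI) (linB lI) IU.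
have IN x : I (N x) = N (I x).
  by rewrite -[LHS]NK -IU// -(linB lI) NP.
exists (I \o N); split.
  split => [y|x dx|].
  - have [d E] := dI (N y); split => //=.
    by rewrite scale0r sub0r E opprB NP.
  - by rewrite /= scale0r sub0r IN -(add0r (- _)) (linB lI) (lin0 lI) sub0r IB// opprB NK.
  - have [M1' M1'0 IM] := bI; have [M2 M20 NM] := bN.
    exists (M1' * M2) => [|x]; first exact: mulr_gt0.
    by rewrite (le_trans (IM _))// -mulrA ler_pM2l.
move=> K cK KU x Kx; have [Kcl K0 KD KZ] := cK.
apply: (orbit_int_preserves CU M1 UM) => //.
by apply: Ncone Kx => // y Ky; apply: KU.
Unshelve. all: by end_near. Qed.

Definition pair_op (V W : normedModType R) (A : operator V) (B : operator W) :
    operator (V * W)%type :=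
  @Operator _ (V * W)%type [set z | dom A z.1 /\ dom B z.2]
    (fun z => (A z.1, B z.2)).

Definition pair_fun (V W : Type) (f : V -> V) (g : W -> W) (z : V * W) :=
  (f z.1, g z.2).

Lemma fst_cont (V W : normedModType R) : continuous (fst : V * W -> V).
Proof.
apply: linear_bounded_cont; first by move=> a x y.
by apply: (bounded_opW (M := 1)) => x; rewrite mul1r prod_normE le_max lexx.
Qed.

Lemma snd_cont (V W : normedModType R) : continuous (snd : V * W -> W).
Proof.
apply: linear_bounded_cont; first by move=> a x y.
by apply: (bounded_opW (M := 1)) => x;
  rewrite mul1r prod_normE le_max lexx orbT.
Qed.

Lemma cvg_pairP (V W : normedModType R) T (F : set_system T) {FF : ProperFilter F}
    (f : T -> V * W) (z : V * W) :
  f t @[t --> F] --> z <->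
  (f t).1 @[t --> F] --> z.1 /\ (f t).2 @[t --> F] --> z.2.
Proof.
split=> [fz|[f1 f2]].
  by split; apply: continuous_cvg_at fz; [exact: fst_cont|exact: snd_cont].
apply/cvgrPdist_lt => e e0; near=> t.
rewrite prod_normE gt_max; apply/andP; split; near: t.
  by move/cvgrPdist_lt : f1; apply.
by move/cvgrPdist_lt : f2; apply.
Unshelve. all: by end_near. Qed.

Variables (V W : normedModType R) (S : R -> V -> V) (T : R -> W -> W).

Lemma pair_C0_semigroup : C0_semigroup S -> C0_semigroup T ->
  C0_semigroup (fun t => pair_fun (S t) (T t) : (V * W) -> (V * W)%type).
Proof.
move=> [Sl S0 SD Sc] [Tl T0 TD Tc]; split.
- move=> t t0; have [lS cS] := Sl t t0; have [lT cT] := Tl t t0.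
  split; first by move=> a x y; rewrite /pair_fun /= lS lT.
  move=> x; apply/cvg_pairP; split.
    apply: (continuous_cvg_at (g := fst) cS); exact: fst_cont.
  apply: (continuous_cvg_at (g := snd) cT); exact: snd_cont.
- by apply/funext => -[x y]; rewrite /pair_fun S0 T0.
- by move=> s t s0 t0; apply/funext => -[x y]; rewrite /pair_fun /= SD// TD.
- by move=> x; apply/cvg_pairP; split; [exact: Sc|exact: Tc].
Qed.

Lemma pair_generator (A : operator V) (B : operator W) :
  is_generator S A -> is_generator T B ->
  is_generator (fun t => pair_fun (S t) (T t) : (V * W) -> (V * W)%type)
    (pair_op A B).
Proof.
move=> [Ad Al] [Bd Bl]; split => [z|z [d1 d2]]; last first.
  by apply/cvg_pairP; split; [exact: Al|exact: Bl].
split=> [[d1 d2]|[y /cvg_pairP[y1 y2]]].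
  by exists (A z.1, B z.2); apply/cvg_pairP; split; [exact: Al|exact: Bl].
by split; [apply/Ad; exists y.1|apply/Bd; exists y.2].
Qed.

End Generators.

(** * Perturbing a semigroup by a commuting group; rotations *)

Section Twist.
Variables (R : realType).

(** Strong convergence of uniformly bounded operators allows the argument to
    vary as well. *)
Lemma cvg_bounded_apply (V : normedModType R) T (F : set_system T)
    {FF : ProperFilter F} (L : T -> V -> V) (M : R) (g : T -> V) (x y : V) :
  0 < M -> (forall t, linear (L t)) ->
  (\forall t \near F, forall z, `|L t z| <= M * `|z|) ->
  L t x @[t --> F] --> y -> g t @[t --> F] --> x ->
  L t (g t) @[t --> F] --> y.
Proof.
move=> M0 lL LM Lx gx; apply/cvgrPdist_le => e e0.
near=> t.
rewrite -(subrK (L t x) y) -addrA (le_trans (ler_normD _ _))//.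
rewrite [e]splitr lerD//; near: t.
  by move/cvgrPdist_le : Lx; apply; rewrite divr_gt0.
near=> t.
have LMt : forall z, `|L t z| <= M * `|z| by near: t.
rewrite -(linB (lL t)) (le_trans (LMt _))// -ler_pdivlMl//.
near: t; move/cvgrPdist_le : gx; apply.
by rewrite mulr_gt0 ?invr_gt0// divr_gt0.
Unshelve. all: by end_near. Qed.

Variables (V : normedModType R) (S G : R -> V -> V) (D : V -> V) (M : R).
Hypotheses (lG : forall t, linear (G t)) (bG : forall t, bounded_op (G t)).
Hypotheses (M0 : 0 < M) (GM : forall t x, `|t| <= 1 -> `|G t x| <= M * `|x|).
Hypotheses (G0 : forall x, G 0 x = x)
  (GD : forall s t x, G (s + t) x = G s (G t x)).
Hypothesis GS : forall s t x, 0 <= t -> G s (S t x) = S t (G s x).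
Hypothesis Gd : forall x, h^-1 *: (G h x - x) @[h --> 0^'+] --> D x.

Let nearG : \forall h \near (0 : R)^'+, forall z, `|G h z| <= M * `|z|.
Proof.
near=> h => z; apply: GM; rewrite ger0_norm; first by near: h; exact: nbhs_right_le.
by near: h; exact: nbhs_right_ge.
Unshelve. all: by end_near. Qed.

Let nearGN : \forall h \near (0 : R)^'+, forall z, `|G (- h) z| <= M * `|z|.
Proof.
near=> h => z; apply: GM; rewrite normrN ger0_norm.
  by near: h; exact: nbhs_right_le.
by near: h; exact: nbhs_right_ge.
Unshelve. all: by end_near. Qed.

Let Gc x : G h x @[h --> 0^'+] --> x.
Proof.
have id0 : h @[h --> (0 : R)^'+] --> (0 : R).
  by apply: cvg_at_right_filter; exact: cvg_id.
have lim : h *: (h^-1 *: (G h x - x)) + x @[h --> 0^'+] --> 0 *: D x + x.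
  by apply: cvgD; [exact: (cvgZ id0 (@Gd x)) | exact: cvg_cst].
rewrite scale0r add0r in lim.
apply: (cvg_near_eq lim); near=> h.
have h0 : h != 0 by rewrite gt_eqF//; near: h; exact: nbhs_right_gt.
by rewrite scalerA mulfV// scale1r subrK.
Unshelve. all: by end_near. Qed.

Let GNc x : G (- h) x @[h --> 0^'+] --> x.
Proof.
have c0 : G (- h) 0 @[h --> 0^'+] --> (0 : V).
  by under eq_fun do rewrite (lin0 (lG _)); exact: cvg_cst.
have c1 : G h x - x @[h --> 0^'+] --> (0 : V).
  by rewrite -(subrr x); apply: cvgB => //; exact: cvg_cst.
have H : G (- h) (G h x - x) @[h --> 0^'+] --> (0 : V).
  exact: (cvg_bounded_apply M0 (fun h => lG (- h)) nearGN c0 c1).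
have lim : x - G (- h) (G h x - x) @[h --> 0^'+] --> x - 0.
  by apply: cvgB => //; exact: cvg_cst.
rewrite subr0 in lim; apply: (cvg_near_eq lim); near=> h.
by rewrite (linB (lG _)) -GD addNr G0 opprB addrCA subrr addr0.
Unshelve. all: by end_near. Qed.

Lemma twist_C0_semigroup : C0_semigroup S -> C0_semigroup (fun t x => G t (S t x)).
Proof.
move=> [Sl S0 SD Sc]; split.
- move=> t t0; have [lS cS] := Sl t t0; split.
    by move=> a x y; rewrite lS lG.
  have cG : continuous (G t) := linear_bounded_cont (lG t) (bG t).
  by move=> x; apply: (continuous_cvg_at cG); exact: cS.
- by apply/funext => x; rewrite S0 G0.
- move=> s t s0 t0; apply/funext => x /=.
  by rewrite SD// -GS// -GD addrC /= GD -!GS// -!GD addrC.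
- move=> x; exact: (cvg_bounded_apply M0 _ nearG (@Gc x) (Sc x)).
Qed.

(** The product rule at time [0]. As [G] is a group, [S] is recovered from the
    twisted semigroup by twisting with [G (- t)], so the domain is the same. *)
Lemma twist_generator B : C0_semigroup S -> is_generator S B ->
  is_generator (fun t x => G t (S t x))
    (Operator (dom B) (fun x => B x + D x)).
Proof.
move=> [Sl S0 SD Sc] [Bd Bl].
have lim x : dom B x ->
    h^-1 *: (G h (S h x) - x) @[h --> 0^'+] --> B x + D x.
  move=> dx.
  have c1 : G h (h^-1 *: (S h x - x)) @[h --> 0^'+] --> B x.
    exact: (cvg_bounded_apply M0 lG nearG (@Gc (B x)) (Bl x dx)).
  apply: (cvg_near_eq (cvgD c1 (@Gd x))); near=> h.
  by rewrite (linZ (lG _)) (linB (lG _)) -scalerDr addrA subrK.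
split => [x|x]; last exact: lim.
split=> [dx|[y xy]]; first by exists (B x + D x); exact: lim.
apply/Bd; exists (y - D x).
have c1 : G (- h) (h^-1 *: (G h (S h x) - x)) @[h --> 0^'+] --> y.
  exact: (cvg_bounded_apply M0 (fun h => lG (- h)) nearGN (@GNc y) xy).
have c2 : G (- h) (h^-1 *: (G h x - x)) @[h --> 0^'+] --> D x.
  exact: (cvg_bounded_apply M0 (fun h => lG (- h)) nearGN
    (@GNc (D x)) (@Gd x)).
apply: (cvg_near_eq (cvgB c1 c2)); near=> h.
rewrite /= [X in _ = _ + X]/GRing.opp /= !(linZ (lG _)) !(linB (lG _)) -!GD addNr !G0 -scalerBr.
by congr (_ *: _); rewrite opprB addrA subrK.
Unshelve. all: by end_near. Qed.

End Twist.

Section Rotation.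
Variables (R : realType) (X : normedModType R).
Implicit Types (A : operator X) (T : R -> X -> X) (w : (X * X * X)%type).

(** [A - i eta] on the complexification, as a real operator. *)
Definition rot_op A (eta : R) : operator (X * X)%type :=
  @Operator _ (X * X)%type [set z | dom A z.1 /\ dom A z.2]
    (fun z => (A z.1 + eta *: z.2, A z.2 - eta *: z.1)).

(** Multiplication of [u + i v] by [exp (- i a)], with a third component left
    alone. *)
Definition rot (a : R) w : (X * X * X)%type :=
  (cos a *: w.1.1 + sin a *: w.1.2, cos a *: w.1.2 - sin a *: w.1.1, w.2).

Definition triple T (t : R) : (X * X * X) -> (X * X * X)%type :=
  pair_fun (pair_fun (T t) (T t)) (T t).

Lemma rot_linear a : linear (rot a).
Proof.
move=> b [[u v] y] [[u' v'] y']; rewrite /rot /=; congr (_, _, _).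
  rewrite -[RHS]/(b *: (cos a *: u + sin a *: v) + (cos a *: u' + sin a *: v')).
  rewrite !scalerDr addrACA !scalerA.
  by congr (_ + _ + _); congr (_ *: _); exact: mulrC.
rewrite -[RHS]/(b *: (cos a *: v - sin a *: u) + (cos a *: v' - sin a *: u')).
rewrite !scalerDr !scalerN !scalerA opprD addrACA.
by congr (_ - _ + _); congr (_ *: _); exact: mulrC.
Qed.

Lemma rotD a b w : rot (a + b) w = rot a (rot b w).
Proof.
case: w => [[u v] y]; rewrite /rot /=; congr (_, _, _).
  rewrite cosD sinD !scalerDl scaleNr !scalerDr !scalerN !scalerA.
  by rewrite -!addrA; congr (_ + _); rewrite addrC -addrA addrCA.
rewrite cosD sinD !scalerDl scaleNr !scalerDr !scalerN !scalerA !opprD.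
by rewrite -!addrA; congr (_ + _); rewrite addrC -addrA addrCA.
Qed.

Lemma rot0 w : rot 0 w = w.
Proof.
by case: w => [[u v] y]; rewrite /rot /= cos0 sin0 !scale1r !scale0r addr0 subr0.
Qed.

Lemma rot_bound a w : `|rot a w| <= 2 * `|w|.
Proof.
case: w => [[u v] y].
have [u1 v1 y1] : [/\ `|u| <= `|(u, v, y)|, `|v| <= `|(u, v, y)| &
    `|y| <= `|(u, v, y)| ].
  by rewrite !prod_normE/= !le_max !lexx !orbT.
have c1 : `|cos a| <= 1 by rewrite ler_norml cos_geN1 cos_le1.
have s1 : `|sin a| <= 1 by rewrite ler_norml sin_geN1 sin_le1.
have H (b : R) x : `|b| <= 1 -> `|x| <= `|(u, v, y)| ->
    `|b *: x| <= `|(u, v, y)|.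
  by move=> b1 x1; rewrite normrZ (le_trans _ x1)// ler_piMl.
set n := `|(u, v, y)| in u1 v1 y1 H *.
rewrite /rot !prod_normE/= !ge_max mulr2n mulrDl mul1r.
rewrite (le_trans (ler_normD _ _)) ?lerD ?H//.
rewrite (le_trans (ler_normB _ _)) ?lerD ?H//=.
by rewrite (le_trans y1)// lerDl (le_trans _ u1).
Qed.

Lemma rot_triple T a t w : linear (T t) ->
  rot a (triple T t w) = triple T t (rot a w).
Proof.
move=> lT; case: w => [[u v] y]; rewrite /rot /triple /pair_fun /=.
by rewrite (linB lT) (linD lT) !(linZ lT).
Qed.

End Rotation.

(** * Resolvents of direct sums and of rotated operators *)

Section RightDerivatives.
Variable R : realType.

Lemma right_derivative (f : R -> R) (d : R) : is_derive (0 : R) (1 : R) f d ->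
  h^-1 * (f h - f 0) @[h --> 0^'+] --> d.
Proof.
move=> [df fd].
have lim : h^-1 *: (f (h *: 1 + 0) - f 0) @[h --> (0 : R)^'] --> d.
  by rewrite -fd; exact: df.
have H1 : h^-1 *: (f (h *: 1 + 0) - f 0) @[h --> (0 : R)^'+] --> d.
  exact: cvg_dnbhs_at_right lim.
apply: (cvg_near_eq H1); near=> h.
by rewrite addr0 /GRing.scale/= mulr1.
Unshelve. all: by end_near. Qed.

Lemma damped_derivatives (mu eta : R) :
  [/\ h^-1 * (expR (- (mu * h)) * cos (eta * h) - 1) @[h --> 0^'+] --> - mu,
      h^-1 * (expR (- (mu * h)) * sin (eta * h)) @[h --> 0^'+] --> eta &
      h^-1 * (expR (- (mu * h)) - 1) @[h --> 0^'+] --> - mu].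
Proof.
have e0 : expR (- (mu * 0)) = 1 :> R by rewrite mulr0 oppr0 expR0.
have c0 : cos (eta * 0) = 1 :> R by rewrite mulr0 cos0.
have s0 : sin (eta * 0) = 0 :> R by rewrite mulr0 sin0.
split.
- have d : is_derive (0 : R) (1 : R)
      (fun h => expR (- (mu * h)) * cos (eta * h)) (- mu).
    apply: is_derive_eq; rewrite /= /GRing.scale /= e0 c0 s0; ring.
  apply: (cvg_near_eq (right_derivative d)); near=> h.
  by rewrite e0 c0 mulr1.
- have d : is_derive (0 : R) (1 : R)
      (fun h => expR (- (mu * h)) * sin (eta * h)) eta.
    apply: is_derive_eq; rewrite /= /GRing.scale /= e0 c0 s0; ring.
  apply: (cvg_near_eq (right_derivative d)); near=> h.
  by rewrite e0 s0 mulr0 subr0.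
- have d : is_derive (0 : R) (1 : R) (fun h => expR (- (mu * h))) (- mu).
    apply: is_derive_eq; rewrite /= /GRing.scale /= e0; ring.
  apply: (cvg_near_eq (right_derivative d)); near=> h.
  by rewrite e0.
Unshelve. all: by end_near. Qed.

End RightDerivatives.

Section PairResolvent.
Variables (R : realType) (V W : normedModType R).
Variables (A : operator V) (B : operator W).

Lemma pair_op_linear : linear_op A -> linear_op B -> linear_op (pair_op A B).
Proof.
move=> [A0 Al] [B0 Bl]; split=> // a x y [x1 x2] [y1 y2].
have [d1 E1] := Al a _ _ x1 y1; have [d2 E2] := Bl a _ _ x2 y2.
by split => //=; rewrite E1 E2.
Qed.

Lemma pair_resolvent mu S J : is_resolvent A mu S -> is_resolvent B mu J ->
  is_resolvent (pair_op A B) mu (pair_fun S J).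
Proof.
move=> [SP SK [M M0 SM]] [JP JK [N N0 JN]]; split.
- move=> [y z]; have [dy yE] := SP y; have [dz zE] := JP z.
  split => //; rewrite -[RHS]/(y, z) -[in RHS]yE -[in RHS]zE.
  by rewrite /pair_fun/=.
- by move=> [x y] [dx dy]; rewrite /pair_fun /= SK// JK.
- exists (M + N) => [|[x y]]; first exact: addr_gt0.
  rewrite !prod_normE /= ge_max; apply/andP; split.
    apply: le_trans (SM x) _; apply: ler_pM => //; first exact: ltW.
      by rewrite lerDl ltW.
    by rewrite le_max lexx.
  apply: le_trans (JN y) _; apply: ler_pM => //; first exact: ltW.
    by rewrite lerDr ltW.
  by rewrite le_max lexx orbT.
Qed.

Lemma pair_resolvent_fst mu J : linear_op B ->
  is_resolvent (pair_op A B) mu J ->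
  is_resolvent A mu (fun v => (J (v, 0)).1).
Proof.
move=> lB; have dB0 := lB.1; move=> [JP JK [M M0 JM]]; split.
- move=> y; have [[d1 d2]] := JP (y, 0).
  by move=> /(congr1 fst).
- move=> x dx; have := JK (x, 0) (conj dx dB0).
  rewrite -[X in J X]/(mu *: x - A x, mu *: 0 - B 0).
  by rewrite linear_op0// scaler0 subr0 => ->.
- exists M => // v; apply: le_trans (_ : `|J (v, 0)| <= _).
    by rewrite [leRHS]prod_normE le_max lexx.
  by rewrite (le_trans (JM _))// prod_normE/= normr0 (max_idPl _).
Qed.

End PairResolvent.

Section RotationResolvent.
Variables (R : realType) (X : normedModType R) (A : operator X).

Lemma rot_op_linear eta : linear_op A -> linear_op (rot_op A eta).
Proof.
move=> [A0 Al]; split=> // a [u v] [u' v'] [/= du dv] [/= du' dv'].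
have [d1 E1] := Al a _ _ du du'; have [d2 E2] := Al a _ _ dv dv'.
split => //; rewrite /= E1 E2.
rewrite -[RHS]/(a *: (A u + eta *: v) + (A u' + eta *: v'),
   a *: (A v - eta *: u) + (A v' - eta *: u')).
congr pair; rewrite !scalerDr ?scalerN ?opprD addrACA !scalerA.
  by rewrite [a * eta]mulrC.
by rewrite [a * eta]mulrC.
Qed.

Lemma rot_op0 : rot_op A 0 = pair_op A A.
Proof.
congr Operator; apply/funext => -[u v] /=.
by rewrite !scale0r addr0 subr0.
Qed.

Lemma shift_complexifyE (lambda : R[i]) (z : X * X) :
  shift_op lambda (complexify A) z =
  complex.Re lambda *: z - rot_op A (complex.Im lambda) z.
Proof.
case: lambda z => a b [u v]; rewrite -[LHS]/((a *: u - b *: v) - A u,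
   (b *: u + a *: v) - A v).
rewrite -[RHS]/(a *: u - (A u + b *: v), a *: v - (A v - b *: u)).
congr pair; first by rewrite opprD addrA addrAC.
by rewrite opprB addrA [a *: v + _]addrC.
Qed.

(** For [lambda = mu + i eta], the operator [lambda - A] on the complexification
    is [mu - (A - i eta)]. *)
Lemma resolvent_setP (lambda : R[i]) : resolvent_set A lambda <->
  exists S, is_resolvent (rot_op A (complex.Im lambda)) (complex.Re lambda) S.
Proof.
split=> [[S [SP SK [M SM]]]|[S [SP SK [M M0 SM]]]].
  exists S; split.
  - by move=> y; have [d E] := SP y; split => //; rewrite -shift_complexifyE.
  - by move=> x dx; rewrite -shift_complexifyE SK.
  - exact: (bounded_opW SM).
exists S; split.
- by move=> y; have [d E] := SP y; split => //; rewrite shift_complexifyE.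
- by move=> x dx; rewrite shift_complexifyE SK.
- by exists M.
Qed.

End RotationResolvent.

(** * Comparing the resolvents at a complex number and at its real part *)

Section BlockResolvent.
Variables (R : realType) (X : completeNormedModType R).
Variables (T : R -> X -> X) (A : operator X).
Hypotheses (CT : C0_semigroup T) (TA : is_generator T A).

(** The resolvent of this operator at a real [mu] consists of the resolvents of
    [A] at [mu + i eta] and at [mu]. A cone in the product can relate the two. *)
Definition block eta : operator (X * X * X)%type := pair_op (rot_op A eta) A.

Let tripleA := pair_op (pair_op A A) A.

Let triple_C0 : C0_semigroup (triple T).
Proof. by apply: pair_C0_semigroup => //; exact: pair_C0_semigroup. Qed.

Let triple_generator : is_generator (triple T) tripleA.
Proof. by apply: pair_generator => //; exact: pair_generator. Qed.

(** Composed with three copies of [T], this group gives the semigroup generated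
    by [block eta - mu]. *)
Definition damped_rot (mu eta t : R) (w : X * X * X) : (X * X * X)%type :=
  expR (- (mu * t)) *: rot (eta * t) w.

Let damped_drift (mu eta : R) (w : X * X * X) : (X * X * X)%type :=
  (- mu *: w.1.1 + eta *: w.1.2, - mu *: w.1.2 - eta *: w.1.1, - mu *: w.2).

Let damped_rot_derive mu eta w :
  h^-1 *: (damped_rot mu eta h w - w) @[h --> 0^'+] --> damped_drift mu eta w.
Proof.
have [d1 d2 d3] := damped_derivatives mu eta.
case: w => [[u v] y]; rewrite /damped_rot /damped_drift /rot /=.
pose e h := expR (- (mu * h)).
pose c h : R := h^-1 * (e h * cos (eta * h) - 1).
pose s h : R := h^-1 * (e h * sin (eta * h)).
have lim : ((c h *: u + s h *: v, c h *: v - s h *: u), h^-1 * (e h - 1) *: y)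
    @[h --> (0 : R)^'+] -->
    (- mu *: u + eta *: v, - mu *: v - eta *: u, - mu *: y).
  apply/cvg_pairP; split; last exact: cvgZr_tmp.
  apply/cvg_pairP; split => /=.
    by apply: cvgD; exact: cvgZr_tmp.
  by apply: cvgB; exact: cvgZr_tmp.
apply: (cvg_near_eq lim); near=> h.
rewrite -[LHS]/(h^-1 *: (e h *: (cos (eta * h) *: u + sin (eta * h) *: v) - u),
  h^-1 *: (e h *: (cos (eta * h) *: v - sin (eta * h) *: u) - v),
  h^-1 *: (e h *: y - y)).
congr (_, _, _).
- by rewrite [e h *: (_ + _)]scalerDr addrAC (scalerDr h^-1) !scalerA -{2}(scale1r u) -scalerBl
    scalerA /c /s mulrA.
- by rewrite [e h *: (_ - _)]scalerBr addrAC (scalerBr h^-1) !scalerA -{2}(scale1r v) -scalerBl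
    scalerA /c /s mulrA.
- by rewrite -{2}(scale1r y) -scalerBl scalerA.
Unshelve. all: by end_near. Qed.

Let damped_rot_linear mu eta t : linear (damped_rot mu eta t).
Proof.
by move=> a x y; rewrite /damped_rot rot_linear scalerDr !scalerA mulrC.
Qed.

Let damped_rot_bound mu eta t w :
  `|damped_rot mu eta t w| <= expR (- (mu * t)) * 2 * `|w|.
Proof.
rewrite /damped_rot normrZ gtr0_norm ?expR_gt0// -mulrA ler_pM2l ?expR_gt0//.
exact: rot_bound.
Qed.

Let damped_rot_bounded mu eta t : bounded_op (damped_rot mu eta t).
Proof. exact: bounded_opW (@damped_rot_bound mu eta t). Qed.

Let damped_rot_near mu eta t w : `|t| <= 1 ->
  `|damped_rot mu eta t w| <= expR `|mu| * 2 * `|w|.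
Proof.
move=> t1; apply: le_trans (damped_rot_bound _ _ _ _) _.
rewrite ler_wpM2r// ler_pM2r// ler_expR -[leRHS]mulr1.
rewrite (le_trans (ler_norm _))// normrN normrM ler_wpM2l//.
Qed.

Let damped_rot0 mu eta w : damped_rot mu eta 0 w = w.
Proof. by rewrite /damped_rot !mulr0 oppr0 expR0 scale1r rot0. Qed.

Let damped_rotD mu eta s t w :
  damped_rot mu eta (s + t) w = damped_rot mu eta s (damped_rot mu eta t w).
Proof.
rewrite /damped_rot (linZ (rot_linear _)) scalerA -expRD -rotD.
by rewrite !mulrDr opprD.
Qed.

Let triple_linear t : 0 <= t -> linear (triple T t).
Proof. by case: triple_C0 => H _ _ _ /H[]. Qed.

Let T_linear t : 0 <= t -> linear (T t).
Proof. by case: CT => H _ _ _ /H[]. Qed.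

Let damped_rot_triple mu eta s t w : 0 <= t ->
  damped_rot mu eta s (triple T t w) = triple T t (damped_rot mu eta s w).
Proof.
move=> t0; rewrite /damped_rot rot_triple; last exact: T_linear.
by rewrite (linZ (triple_linear t0)).
Qed.

(** The semigroup generated by [block eta - mu] has at time [1] a norm of at most
    [2 * M * exp (- mu)], which is less than [1] for [mu] large, uniformly in
    [eta]. So [generator_resolvent0] applies. *)
Lemma block_resolvent_large : exists omega : R, forall eta mu, omega <= mu ->
  exists J, is_resolvent (block eta) mu J /\
    forall K, closed_cone K ->
      (forall t, 0 <= t -> preserves K (fun w => rot (eta * t) (triple T t w))) ->
      preserves K J.
Proof.
have [M M1 TM] := C0_bounded triple_C0.
exists (2 * M) => eta mu muM.
pose G := damped_rot mu eta.
have M20 : 0 < expR `|mu| * 2 by rewrite mulr_gt0 ?expR_gt0.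
have CU : C0_semigroup (fun t w => G t (triple T t w)) :=
  twist_C0_semigroup (damped_rot_linear mu eta) (damped_rot_bounded mu eta)
    M20 (damped_rot_near mu eta) (damped_rot0 mu eta) (@damped_rotD mu eta)
    (@damped_rot_triple mu eta) (@damped_rot_derive mu eta) triple_C0.
have GU := twist_generator (damped_rot_linear mu eta)
    M20 (damped_rot_near mu eta) (damped_rot0 mu eta) (@damped_rotD mu eta)
    (@damped_rot_derive mu eta) triple_C0 triple_generator.
pose q := expR (- mu) * 2 * M.
have q0 : 0 <= q.
  by rewrite !mulr_ge0 ?expR_ge0// (le_trans _ M1).
have q1 : q < 1.
  rewrite /q -mulrA expRN mulrC ltr_pdivrMr ?expR_gt0// mul1r.
  by rewrite (le_lt_trans muM)// (lt_le_trans _ (expR_ge1Dx _))// ltrDr.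
have Uq w : `|G 1 (triple T 1 w)| <= q * `|w|.
  apply: le_trans (damped_rot_bound _ _ _ _) _.
  by rewrite mulr1 /q -[leRHS]mulrA ler_pM2l ?TM// mulr_gt0 ?expR_gt0.
have [J [Jres JK]] := generator_resolvent0 CU GU q0 q1 Uq.
exists J; split.
  have E w : mu *: w - block eta w =
      0 *: w - (tripleA w + damped_drift mu eta w).
    case: w => [[u v] y]; rewrite -[LHS]/((mu *: u - (A u + eta *: v),
      mu *: v - (A v - eta *: u)), mu *: y - A y).
    rewrite scale0r sub0r -[RHS]/(((- (A u + (- mu *: u + eta *: v))),
      - (A v + (- mu *: v - eta *: u))), - (A y + (- mu *: y))).
    congr (_, _, _); rewrite scaleNr !opprD !opprK; first by rewrite addrCA.
      by rewrite addrCA.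
    by rewrite addrC.
  have [JP JB bJ] := Jres; split => // [y|x dx].
    by have [d Ey] := JP y; split => //; rewrite E.
  by rewrite E JB.
move=> K cK KT; have [_ _ _ KZ] := cK.
apply: JK => // t t0 w Kw.
by apply: KZ; [exact: expR_ge0 | exact: KT].
Qed.

End BlockResolvent.

(** * The open mapping theorem *)

Section OpenMapping.
Variables (R : realType) (P V : completeNormedModType R) (Phi : P -> V).
Hypotheses (lPhi : linear Phi) (bPhi : bounded_op Phi).
Hypothesis Phi_surj : forall y, exists p, Phi p = y.

Let image_ball (j : nat) := closure [set Phi p | p in [set p | `|p| <= j%:R]].

(** The closures of the images of the balls cover the space, so that one of them
    has an interior point by Baire's theorem. *)
Let image_ball_interior : exists j x0, exists2 r : R, 0 < r &
  forall y, `|y - x0| < r -> image_ball j y.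
Proof.
apply: contrapT => H.
have : dense (\bigcap_j ~` image_ball j).
  apply: Baire => j; split; first by apply: closed_openC; exact: closed_closure.
  apply: contrapT => /denseNE[U [[x [Uo Ux]] UE]]; apply: H.
  have /nbhs_normP[r /= r0 rU] : nbhs x U by exact: open_nbhs_nbhs.
  exists j, x, r => // y yr; apply: contrapT => yj.
  suff : (U `&` ~` image_ball j) y by rewrite UE.
  by split => //; apply: rU; rewrite /= distrC.
move=> dE; have [||y [_ Hy]] := dE setT; [by exists 0 | exact: openT |].
have [p py] := Phi_surj y.
apply: (Hy (Num.truncn `|p|).+1 I); apply: subset_closure.
by exists p => //=; exact/ltW/truncnS_gt.
Qed.

Let closure_norm (E : set V) x e : closure E x -> 0 < e ->
  exists2 z, E z & `|x - z| < e.
Proof.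
move=> Ex e0; have [z [Ez xz]] := Ex (ball x e) (nbhsx_ballx x e e0).
by exists z => //; rewrite -ball_normE in xz.
Qed.

Let approx_preimage : exists2 L : R, 0 < L &
  forall y, exists2 p, `|p| <= L * `|y| & `|y - Phi p| <= `|y| / 2.
Proof.
have [j [x0 [r r0 Hr]]] := image_ball_interior.
have near_ball y e : `|y| < r -> 0 < e ->
    exists2 p, `|p| <= 2 * j%:R & `|y - Phi p| <= e.
  move=> yr e0; have e20 : 0 < e / 2 by rewrite divr_gt0.
  have E1 : image_ball j (x0 + y) by apply: Hr; rewrite addrAC subrr add0r.
  have E2 : image_ball j x0 by apply: Hr; rewrite subrr normr0.
  have [_ [p1 p1j <-] d1] := closure_norm E1 e20.
  have [_ [p2 p2j <-] d2] := closure_norm E2 e20.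
  exists (p1 - p2).
    by rewrite (le_trans (ler_normB _ _))// mulr2n mulrDl mul1r lerD.
  rewrite (linB lPhi) [e]splitr.
  have -> : y - (Phi p1 - Phi p2) = (x0 + y - Phi p1) - (x0 - Phi p2).
    rewrite !opprB [LHS]addrA [LHS]addrAC [x0 + y]addrC [y + x0 - _]addrAC.
    by rewrite -[RHS]addrA [x0 + _]addrC subrK.
  by rewrite (le_trans (ler_normB _ _))// lerD ?ltW.
pose L := 4 * (j%:R + 1) / r.
have L0 : 0 < L by rewrite divr_gt0// mulr_gt0// ltr_wpDl.
exists L => // y; have [->|y0] := eqVneq y 0.
  by exists 0; rewrite ?(lin0 lPhi) ?subr0 !normr0 ?mulr0 ?mul0r.
have yp : 0 < `|y| by rewrite normr_gt0.
pose a := r / (2 * `|y|).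
have a0 : 0 < a by rewrite divr_gt0// mulr_gt0.
have ya : `|a *: y| = r / 2.
  by rewrite normrZ gtr0_norm// /a; field; rewrite gt_eqF.
have [||p pj yp'] := near_ball (a *: y) (r / 4).
- by rewrite ya; lra.
- by rewrite divr_gt0.
exists (a^-1 *: p).
  rewrite normrZ gtr0_norm ?invr_gt0// ler_pdivrMl//.
  rewrite (le_trans pj)// /L /a.
  have -> : r / (2 * `|y|) * (4 * (j%:R + 1) / r * `|y|) = 2 * (j%:R + 1).
    by field; rewrite !gt_eqF.
  by rewrite ler_pM2l// lerDl.
rewrite -(ler_pM2l a0) -{1}(gtr0_norm a0) -normrZ scalerBr (linZ lPhi) scalerA.
rewrite mulfV ?gt_eqF// scale1r (le_trans yp')// /a.
by rewrite le_eqVlt; apply/orP; left; apply/eqP; field; rewrite gt_eqF.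
Qed.

(** Approximate preimages with half the error at each step add up to an exact
    one. *)
Lemma open_mapping : exists2 L : R, 0 < L &
  forall y, exists2 p, Phi p = y & `|p| <= L * `|y|.
Proof.
have [L L0 HL] := approx_preimage.
pose h y := s2val (cid2 (HL y)).
have hL y : `|h y| <= L * `|y| by rewrite /h; case: cid2.
have hy y : `|y - Phi (h y)| <= `|y| / 2 by rewrite /h; case: cid2.
exists (2 * L) => [|y]; first by rewrite mulr_gt0.
pose z k := iter k (fun y => y - Phi (h y)) y.
have zb k : `|z k| <= `|y| / 2 ^+ k.
  elim: k => [|k IH]; first by rewrite expr0 divr1.
  rewrite /z iterS -/(z k) (le_trans (hy _))// exprSr invfM mulrA.
  by rewrite ler_pM2r.
pose q (k : nat) : P := h (z k).
have qb k : `|q k| <= L * `|y| / 2 ^+ k.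
  by rewrite (le_trans (hL _))// -mulrA ler_pM2l.
have sb n : \sum_(0 <= k < n) `|q k| <= 2 * L * `|y|.
  apply: (@le_trans _ _ (2 * L * `|y| - 2 * (L * `|y| / 2 ^+ n))); last first.
    by rewrite gerBl mulr_ge0// mulr_ge0// mulr_ge0// ltW.
  elim: n => [|n IH].
    by rewrite big_geq// expr0 divr1 mulrA subrr.
  rewrite big_nat_recr//=; apply: le_trans (lerD IH (qb n)) _.
  rewrite le_eqVlt; apply/orP; left; apply/eqP; rewrite exprS; field.
  by rewrite expf_neq0.
have cq : cvgn (series q).
  apply: normed_cvg; apply: nondecreasing_is_cvgn.
    by apply: nondecreasing_series => k _ _; exact: normr_ge0.
  by exists (2 * L * `|y|) => _ [n _ <-]; exact: sb.
have lim : series q n @[n --> \oo] --> limn (series q) by exact: cq.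
exists (limn (series q)).
  have cPhi : continuous Phi := linear_bounded_cont lPhi bPhi.
  apply: (norm_cvg_unique (continuous_cvg_at cPhi lim)).
  have Ph n : Phi (series q n) = y - z n.
    rewrite /series /=; elim: n => [|n IH].
      by rewrite big_geq// (lin0 lPhi) /z /= subrr.
    rewrite -[z n.+1]/(z n - Phi (h (z n))) big_nat_recr// (linD lPhi) /= IH /q.
    by rewrite opprB addrA addrAC.
  apply/cvgrPdist_le => e e0.
  have [K HK] : exists K : nat, `|y| / e <= K%:R.
    by exists (Num.truncn (`|y| / e)).+1; exact/ltW/truncnS_gt.
  near=> n; rewrite Ph opprB addrC subrK.
  rewrite (le_trans (zb n))//.
  rewrite ler_pdivrMr ?exprn_gt0// -ler_pdivrMl// mulrC (le_trans HK)//.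
  have Kn : (K <= n)%N by near: n; exact: nbhs_infty_ge.
  rewrite -natrX ler_nat (leq_trans Kn)// ltnW// ltn_expl//.
apply: (cvgr_to_le (cvg_norm lim)); apply: nearW => n.
by rewrite (le_trans (ler_norm_sum _ _ _)).
Unshelve. all: by end_near. Qed.

End OpenMapping.

(** * Bounded Fredholm operators *)

HB.instance Definition _ (R : realType) (n : nat) :=
  Uniform_isComplete.Build 'rV[R]_n (@cauchy_cvg 'rV[R]_n).

Section Clusters.
Variable R : realType.
Implicit Types V W : normedModType R.

(** Cluster points of a sequence replace limits of subsequences. *)
Definition seq_cluster V (z : nat -> V) (u : V) :=
  forall e : R, 0 < e -> forall N, exists2 k, (N <= k)%N & `|z k - u| < e.

Lemma seq_cluster_image V W (f : V -> W) z u : linear f -> bounded_op f ->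
  seq_cluster z u -> seq_cluster (f \o z) (f u).
Proof.
move=> lf [M M0 fM] zu e e0 N.
have [|k Nk zk] := zu (M^-1 * e) _ N; first by rewrite mulr_gt0 ?invr_gt0.
exists k => //=; rewrite -(linB lf) (le_lt_trans (fM _))//.
by rewrite -ltr_pdivlMl.
Qed.

Lemma seq_cluster_shift V (z z' : nat -> V) u :
  (forall e : R, 0 < e -> exists N, forall k, (N <= k)%N -> `|z k - z' k| <= e) ->
  seq_cluster z u -> seq_cluster z' u.
Proof.
move=> zz' zu e e0 N; have e20 : 0 < e / 2 by rewrite divr_gt0.
have [N' HN'] := zz' _ e20; have [k] := zu _ e20 (maxn N N').
rewrite geq_max => /andP[Nk N'k] zk; exists k => //.
rewrite -(subrK (z k) (z' k)) -addrA (le_lt_trans (ler_normD _ _))//.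
by rewrite [e]splitr ler_ltD// distrC HN'.
Qed.

Lemma seq_cluster_const V (a u : V) : seq_cluster (fun=> a) u -> u = a.
Proof.
move=> au; apply/eqP; rewrite eq_sym -subr_eq0 -normr_le0.
apply/ler_addgt0Pr => e e0; rewrite add0r.
by have [k _ /ltW] := au e e0 0%N.
Qed.

Lemma seq_cluster_norm V (z : nat -> V) u (r : R) :
  (forall k, `|z k| = r) -> seq_cluster z u -> `|u| = r.
Proof.
move=> zr zu; apply/eqP; rewrite eq_sym -subr_eq0 -normr_le0.
apply/ler_addgt0Pr => e e0; rewrite add0r.
have [k _ /ltW zk] := zu e e0 0%N.
by rewrite (le_trans _ zk)// -(zr k) ler_dist_dist.
Qed.

Lemma inv_natS_small (e : R) : 0 < e ->
  exists N, forall k, (N <= k)%N -> k.+1%:R^-1 <= e.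
Proof.
move=> e0; exists (Num.truncn e^-1) => k Nk.
rewrite -[leRHS]invrK lef_pV2 ?posrE ?invr_gt0//.
by rewrite ltW// -truncn_le_nat.
Qed.

Lemma rV_cluster n (c : nat -> 'rV[R]_n) (M : R) :
  (forall k, `|c k| <= M) -> exists u, seq_cluster c u.
Proof.
move=> cM; pose A := [set v : 'rV[R]_n | `|v| <= M].
have cA : compact A.
  apply: bounded_closed_compact.
    by exists M; split; [exact: num_real | move=> x Mx v /le_trans; apply; exact: ltW].
  apply: (@closed_comp _ _ (fun v : 'rV[R]_n => `|v|) [set x | x <= M]).
    by move=> v _; exact: norm_continuous.
  exact: closed_le.
have FA : (c @ \oo) A by exists 0%N => // k _; exact: cM.
have [u [_ uc]] := cA (c @ \oo) _ FA.
exists u => e e0 N.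
have FN : (c @ \oo) [set c k | k in [set k | (N <= k)%N]].
  by exists N => // k /= Nk; exists k.
have [v [[k Nk <-] uv]] := uc _ _ FN (nbhsx_ballx u e e0).
by exists k => //; rewrite distrC; move: uv; rewrite -ball_normE.
Qed.

End Clusters.

Section Combinations.
Variables (R : realType) (V : normedModType R).

Definition comb n (b : 'I_n -> V) (c : 'rV[R]_n) := \sum_(i < n) c 0 i *: b i.

Lemma comb_linear n (b : 'I_n -> V) : linear (comb b).
Proof.
move=> a c d; rewrite /comb scaler_sumr -big_split/=.
by apply: eq_bigr => i _; rewrite !mxE scalerDl scalerA.
Qed.

Lemma comb_bounded n (b : 'I_n -> V) : bounded_op (comb b).
Proof.
apply: (@bounded_opW _ _ _ _ (\sum_(i < n) `|b i|)) => c.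
rewrite (le_trans (ler_norm_sum _ _ _))// mulr_suml; apply: ler_sum => i _.
rewrite normrZ mulrC ler_wpM2l//.
rewrite [leRHS]/Num.norm/= mx_normrE.
exact: (le_bigmax _ (fun ij => `|c ij.1 ij.2|) (0, i)).
Qed.

Lemma lspanP n (b : 'I_n -> V) x : lspan b x <-> exists c, x = comb b c.
Proof.
split=> [[c ->]|[c ->]]; last by exists (c 0).
by exists (\row_i c i); apply: eq_bigr => i _; rewrite mxE.
Qed.

(** A vector with a nonzero coefficient in a combination can be traded for
    that combination. *)
Lemma comb_drop n (b : 'I_n.+1 -> V) (c d : 'rV[R]_n.+1) j : c 0 j != 0 ->
  exists d', comb b d = (d 0 j / c 0 j) *: comb b c + comb (b \o lift j) d'.
Proof.
move=> cj; exists (\row_i (d 0 (lift j i) - d 0 j / c 0 j * c 0 (lift j i))).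
rewrite /comb (bigD1_ord j)//= [in RHS](bigD1_ord j)//= scalerDr scalerA.
rewrite divfK// -addrA; congr (_ + _).
rewrite scaler_sumr -big_split/=; apply: eq_bigr => i _.
by rewrite mxE scalerBl scalerA addrC subrK.
Qed.

Lemma row_nonzero n (c : 'rV[R]_n) : c != 0 -> exists j, c 0 j != 0.
Proof.
move=> c0; apply: contrapT => H; move/eqP: c0; apply.
apply/rowP => j; rewrite mxE; apply/eqP; apply: contrapT => cj.
by apply: H; exists j; apply/negP.
Qed.

(** Vectors of bounded norm in the span of independent vectors have bounded
    coefficients, to which compactness in [R^n] applies. Otherwise one of the
    spanning vectors is superfluous. *)
Lemma lspan_cluster n (b : 'I_n -> V) (z : nat -> V) (M : R) :
  (forall k, lspan b (z k)) -> (forall k, `|z k| <= M) ->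
  exists u, seq_cluster z u.
Proof.
elim: n b => [|n IH] b zb zM.
  exists 0 => e e0 N; exists N => //.
  by have [c ->] := zb N; rewrite big_ord0 subr0 normr0.
have [[c [c0 cb]]|indep] := pselect (exists c, c != 0 /\ comb b c = 0).
  have [j cj] := row_nonzero c0.
  apply: (IH (b \o lift j)) => // k; have /lspanP[d ->] := zb k.
  have [d' ->] := comb_drop b d cj; rewrite cb scaler0 add0r.
  by apply/lspanP; exists d'.
have lc := comb_linear b; have bc := comb_bounded b.
(* If the coefficients were not controlled, unit vectors of coefficients would
   cluster at a nontrivial relation between the [b i]. *)
have [d d0 dP] : exists2 d : R, 0 < d & forall c, d * `|c| <= `|comb b c|.
  apply: contrapT => H.
  have bad (k : nat) : exists c, `|comb b c| < k.+1%:R^-1 * `|c|.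
    apply: contrapT => Hk; apply: H; exists k.+1%:R^-1.
      by rewrite invr_gt0.
    by move=> c; rewrite leNgt; apply/negP => Hc; apply: Hk; exists c.
  pose c k := sval (cid (bad k)).
  have cP k : `|comb b (c k)| < k.+1%:R^-1 * `|c k| by rewrite /c; case: cid.
  have cn k : c k != 0.
    apply: contraTneq (cP k) => ->.
    by rewrite (lin0 lc) !normr0 mulr0 ltxx.
  pose e k := `|c k|^-1 *: c k.
  have e1 k : `|e k| = 1 by exact: normfZV.
  have [|u eu] := @rV_cluster _ _ e 1; first by move=> k; rewrite e1.
  apply: indep; exists u; split.
    by rewrite -normr_gt0 (seq_cluster_norm e1 eu).
  apply: seq_cluster_const (_ : seq_cluster (fun=> 0) _).
  apply: seq_cluster_shift (seq_cluster_image lc bc eu) => r r0.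
  have [N HN] := inv_natS_small r0; exists N => k Nk.
  rewrite subr0 /= (linZ lc) normrZ normfV normr_id.
  rewrite ler_pdivrMl ?normr_gt0// (le_trans (ltW (cP k)))// mulrC.
  by rewrite ler_wpM2l// HN.
pose c k := sval (cid ((lspanP b (z k)).1 (zb k))).
have cE k : z k = comb b (c k) by rewrite /c; case: cid.
have [|u cu] := @rV_cluster _ _ c (d^-1 * M).
  move=> k; rewrite ler_pdivlMl// (le_trans (dP _))// -cE.
  exact: zM.
exists (comb b u); have -> : z = comb b \o c by apply/funext => k; exact: cE.
exact: seq_cluster_image.
Qed.

End Combinations.

Section Fredholm.
Variables (R : realType) (V : completeNormedModType R) (K : V -> V).
Hypotheses (lK : linear K) (bK : bounded_op K).
Hypothesis codimK : finite_codim (range K).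

(** A finite spanning family modulo the range, chosen minimal, is independent
    modulo the range. *)
Lemma finite_codim_independent : exists n (b : 'I_n -> V),
  (forall y, exists x c, y = K x + comb b c) /\
  (forall c, range K (comb b c) -> c = 0).
Proof.
have [n [b span]] := codimK.
have {}span y : exists x c, y = K x + comb b c.
  by have [_ [w [[x _ <-] /lspanP[c ->] ->]]] := span y; exists x, c.
elim: n b span => [|n IH] b span.
  by exists 0%N, b; split => // c _; apply/rowP => -[].
have [[c [c0 [x0 _ x0c]]]|indep] :=
    pselect (exists c, c != 0 /\ range K (comb b c)); last first.
  exists n.+1, b; split => // c Kc; apply/eqP; apply: contrapT => /negP c0.
  by apply: indep; exists c.
have [j cj] := row_nonzero c0.
apply: (IH (b \o lift j)) => y; have [x [d ->]] := span y.
have [d' ->] := comb_drop b d cj.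
exists (x + (d 0 j / c 0 j) *: x0), d'.
by rewrite (linD lK) (linZ lK) x0c addrA.
Qed.

(** The open mapping theorem for the map [(x, c) |-> K x + comb b c], which is
    onto. *)
Lemma fredholm_solve : exists n (b : 'I_n -> V),
  (forall c, range K (comb b c) -> c = 0) /\
  exists2 L : R, 0 < L & forall y, exists x c,
    [/\ y = K x + comb b c, `|x| <= L * `|y| & `|c| <= L * `|y|].
Proof.
have [n [b [span indep]]] := finite_codim_independent.
exists n, b; split => //.
pose Phi (p : V * 'rV[R]_n) := K p.1 + comb b p.2.
have lPhi : linear Phi.
  move=> a p q; rewrite /Phi /= lK comb_linear scalerDr.
  by rewrite addrACA.
have bPhi : bounded_op Phi.
  have [M M0 KM] := bK; have [N N0 bN] := comb_bounded b.
  apply: (@bounded_opW _ _ _ _ (M + N)) => p.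
  rewrite (le_trans (ler_normD _ _))// mulrDl lerD//.
    by rewrite (le_trans (KM _))// ler_pM2l// prod_normE le_max lexx.
  by rewrite (le_trans (bN _))// ler_pM2l// prod_normE le_max lexx orbT.
have [|L L0 HL] := open_mapping lPhi bPhi.
  by move=> y; have [x [c ->]] := span y; exists (x, c).
exists L => // y; have [[x c] <- pL] := HL y; exists x, c.
by split => //; apply: le_trans pL; rewrite prod_normE le_max lexx ?orbT.
Qed.

(** For [y = K x + comb b c] close to the range, the solution of small norm for
    the difference has the opposite coefficients [- c], by independence; so
    [c] is arbitrarily small. *)
Lemma fredholm_closed_range y :
  (forall e : R, 0 < e -> exists x, `|K x - y| <= e) -> exists x, K x = y.
Proof.
move=> ay; have [n [b [indep [L L0 HL]]]] := fredholm_solve.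
have [x [c [yE _ _]]] := HL y; exists x.
suff c0 : c = 0 by rewrite yE c0 (lin0 (comb_linear b)) addr0.
apply/eqP; rewrite -normr_le0; apply/ler_addgt0Pr => e e0; rewrite add0r.
have [|x' x'y] := ay (L^-1 * e); first by rewrite mulr_gt0 ?invr_gt0.
have [x'' [c' [E _ c'L]]] := HL (K x' - y).
suff -> : c = - c'.
  by rewrite normrN (le_trans c'L)// -ler_pdivlMl.
apply/eqP; rewrite -addr_eq0; apply/eqP; apply: indep.
exists (x' - x - x'') => //.
rewrite !(linB lK) (linD (comb_linear b)).
have -> : comb b c = y - K x by rewrite yE addrC addKr.
have -> : comb b c' = K x' - y - K x'' by rewrite E addrC addKr.
by rewrite addrCA addrA addrA subrK; rewrite addrAC.
Qed.

(** Correcting [x k] by a preimage of [K (x k)] of small norm puts it into the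
    finite-dimensional kernel, where bounded sequences cluster. *)
Lemma fredholm_cluster (x : nat -> V) (M : R) :
  finite_dim [set x | K x = 0] ->
  (forall k, `|x k| <= M) ->
  (forall e : R, 0 < e -> exists N, forall k, (N <= k)%N -> `|K (x k)| <= e) ->
  exists2 u, seq_cluster x u & K u = 0.
Proof.
move=> [m [b' kerb']] xM Kx0.
have [n [b [indep [L L0 HL]]]] := fredholm_solve.
have sol k : exists2 x', K x' = K (x k) & `|x'| <= L * `|K (x k)|.
  have [x' [c [E x'L _]]] := HL (K (x k)); exists x' => //.
  suff c0 : c = 0 by rewrite E c0 (lin0 (comb_linear b)) addr0.
  apply: indep; exists (x k - x') => //.
  by rewrite (linB lK) E addrC addKr.
pose x' k := s2val (cid2 (sol k)).
have Kx' k : K (x' k) = K (x k) by rewrite /x'; case: cid2.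
have x'L k : `|x' k| <= L * `|K (x k)| by rewrite /x'; case: cid2.
have [N N0 KN] := bK.
have [||u zu] := @lspan_cluster _ _ _ b' (fun k => x k - x' k) (M + L * (N * M)).
- by move=> k; apply: kerb'; rewrite /= (linB lK) Kx' subrr.
- move=> k; rewrite (le_trans (ler_normB _ _))// lerD//.
  by rewrite (le_trans (x'L k))// ler_pM2l// (le_trans (KN _))// ler_pM2l.
have xu : seq_cluster x u.
  apply: seq_cluster_shift zu => e e0.
  have [|N' HN'] := Kx0 (L^-1 * e); first by rewrite mulr_gt0 ?invr_gt0.
  exists N' => k N'k; rewrite addrAC subrr add0r normrN (le_trans (x'L k))//.
  by rewrite -ler_pdivlMl// HN'.
exists u => //; apply: seq_cluster_const (_ : seq_cluster (fun=> 0) _).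
apply: seq_cluster_shift (seq_cluster_image lK bK xu) => e e0.
by have [N' HN'] := Kx0 e e0; exists N' => k N'k; rewrite subr0; exact: HN'.
Qed.

End Fredholm.

(** * Eigenvectors at a singularity of the resolvent *)

Section SingularResolvent.
Variables (R : realType) (V : completeNormedModType R) (A : operator V).
Variables (alpha : R) (G : set V).
Hypotheses (lA : linear_op A)
  (Ares : forall mu, alpha < mu -> exists J, is_resolvent A mu J)
  (Asing : ~ exists J, is_resolvent A alpha J)
  (Afred : fredholm (shift_op alpha A))
  (Gdense : dense [set z | exists x y, [/\ G x, G y & z = x - y]]).

(** If [alpha - A] is onto, then by the open mapping theorem the resolvents
    stay bounded as they approach [alpha], so that one of them can be shifted
    to [alpha]. *)
Let not_onto S : is_resolvent A (alpha + 1) S ->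
  ~ forall y, exists x, x - S x = y.
Proof.
move=> Sres onto; apply: Asing.
have [SP SK [N N0 SN]] := Sres.
have lS := resolvent_linear lA Sres.
have KE x : x - S x = alpha *: S x - A (S x).
  by have [_ {1}<-] := SP x; rewrite scalerDl scale1r addrAC addrK.
have lK : linear (fun x => x - S x).
  by move=> a x y; rewrite lS opprD addrACA -scalerBr.
have bK : bounded_op (fun x => x - S x).
  apply: (@bounded_opW _ _ _ _ (1 + N)) => x.
  by rewrite (le_trans (ler_normB _ _))// mulrDl mul1r lerD.
have [L L0 HL] := open_mapping lK bK onto.
pose a := N * L; have a0 : 0 < a by rewrite mulr_gt0.
have [|k Hk] := @inv_natS_small R (a^-1 / 4); first by rewrite divr_gt0 ?invr_gt0.
pose t := k.+1%:R^-1 : R.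
have t0 : 0 < t by rewrite invr_gt0.
have ta : t * a <= 4^-1.
  by rewrite -ler_pdivlMr// mulrC Hk.
have [J Jres] : exists J, is_resolvent A (alpha + t) J.
  by apply: Ares; rewrite ltrDl.
have lJ := resolvent_linear lA Jres.
have [JP JK [C C0 JC]] := Jres.
(* For [y = K x], the resolvent identity expresses [J y] through [S x] and
   [t J (S x)], which improves any bound [D] on [J] to [a + D / 4]. *)
have improve D : 0 <= D -> (forall y, `|J y| <= D * `|y|) ->
    forall y, `|J y| <= (a + D / 4) * `|y|.
  move=> D0 JD y; have [x <- xL] := HL y.
  have dS := (SP x).1.
  have Sa : `|S x| <= a * `|x - S x|.
    by rewrite (le_trans (SN x))// /a -mulrA ler_pM2l.
  rewrite {1}KE.
  have -> : J (alpha *: S x - A (S x)) = S x - t *: J (S x).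
    have -> : alpha *: S x - A (S x) =
        ((alpha + t) *: S x - A (S x)) - t *: S x.
      by rewrite scalerDl addrAC addrK.
    by rewrite (linB lJ) (linZ lJ) JK.
  rewrite (le_trans (ler_normB _ _))// normrZ gtr0_norm// mulrDl lerD//.
  apply: (@le_trans _ _ (t * (D * (a * `|x - S x|)))).
    by rewrite ler_pM2l// (le_trans (JD _))// ler_wpM2l.
  set z := `|x - S x|.
  have -> : t * (D * (a * z)) = t * a * (D * z) by ring.
  have -> : D / 4 * z = 4^-1 * (D * z) by ring.
  by rewrite ler_wpM2r// mulr_ge0// /z.
have iter_bound m y : `|J y| <= (2 * a + C / 4 ^+ m) * `|y|.
  elim: m y => [|m IH] y.
    rewrite expr0 divr1 (le_trans (JC y))// ler_wpM2r// lerDr.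
    by rewrite mulr_ge0// ltW.
  have D0 : 0 <= 2 * a + C / 4 ^+ m.
    by rewrite addr_ge0 ?mulr_ge0 ?invr_ge0 ?exprn_ge0// ltW.
  apply: le_trans (improve _ D0 IH y) _; rewrite ler_wpM2r//.
  by rewrite exprS invfM; set q := _ ^-1; lra.
pose m := (Num.truncn (4 * t * C)).+1.
have tC : t * (C / 4 ^+ m) <= 4^-1.
  rewrite mulrA ler_pdivrMr ?exprn_gt0// -ler_pdivrMl ?invr_gt0// invrK mulrA.
  apply: (@le_trans _ _ m%:R); first exact/ltW/truncnS_gt.
  by rewrite -natrX ler_nat ltnW// ltn_expl.
have M0 : 0 <= 2 * a + C / 4 ^+ m.
  by rewrite addr_ge0 ?mulr_ge0 ?invr_ge0 ?exprn_ge0// ltW.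
have tM : `|t| * (2 * a + C / 4 ^+ m) < 1.
  by rewrite gtr0_norm// mulrDr mulrCA; lra.
have [J' [J'res _ _]] := resolvent_shift lA Jres (iter_bound m) M0 tM.
by exists J'; rewrite addrK in J'res.
Qed.

(** Let [S] be the resolvent at [alpha + 1] and [K = 1 - S], so that
    [K = (alpha - A) S] is a bounded Fredholm operator. If the resolvents near
    [alpha] were bounded on every [g] in [G], then each [g] would be a limit of
    the vectors [(alpha - A) J g], hence in the closed range of [K], and [K]
    would be onto, against [not_onto]. So they blow up on some [g]; the
    normalised vectors [u] satisfy [(alpha - A) u -> 0] and cluster at an
    eigenvector by [fredholm_cluster]. *)
Lemma singular_resolvent_cluster : exists g u,
  [/\ G g, `|u| = 1, dom A u /\ A u = alpha *: u &
    forall e : R, 0 < e -> exists mu J r,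
      [/\ alpha < mu /\ mu <= alpha + e, is_resolvent A mu J, e^-1 < r &
        `|r^-1 *: J g - u| < e]].
Proof.
pose t (k : nat) : R := k.+1%:R^-1.
have t0 k : 0 < t k by rewrite invr_gt0.
have Jex k : exists J, is_resolvent A (alpha + t k) J.
  by apply: Ares; rewrite ltrDl.
pose J k := sval (cid (Jex k)).
have Jres k : is_resolvent A (alpha + t k) (J k) by rewrite /J; case: cid.
have [S Sres] : exists S, is_resolvent A (alpha + 1) S.
  by apply: Ares; rewrite ltrDl.
have [SP SK [N N0 SN]] := Sres.
have lS := resolvent_linear lA Sres.
have KE x : x - S x = alpha *: S x - A (S x).
  by have [_ {1}<-] := SP x; rewrite scalerDl scale1r addrAC addrK.
have KR w : dom A w -> let v := (alpha + 1) *: w - A w in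
    S v = w /\ v - S v = alpha *: w - A w.
  by move=> dw /=; rewrite KE SK.
pose K x := x - S x.
have lK : linear K.
  by move=> a x y; rewrite /K lS opprD addrACA -scalerBr.
have bK : bounded_op K.
  apply: (@bounded_opW _ _ _ _ (1 + N)) => x.
  by rewrite (le_trans (ler_normB _ _))// mulrDl mul1r lerD.
have [[m1 [b1 kerb1]] [m2 [b2 ranb2]]] := Afred.
have dimK : finite_dim [set x | K x = 0].
  exists m1, b1 => x /= Kx; apply: kerb1.
  have xS : x = S x by apply/eqP; rewrite -subr_eq0; apply/eqP.
  by rewrite xS; split; [exact: (SP x).1|rewrite /= -KE -xS subrr].
have codimK : finite_codim (range K).
  exists m2, b2 => x; have [v [w [[z dz <-] wb ->]]] := ranb2 x.
  exists ((shift_op alpha A) z), w; split => //.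
  by exists ((alpha + 1) *: z - A z) => //; exact: (KR z dz).2.
(* The norms exceed every bound infinitely often; otherwise the range of [K]
   contains [G], hence everything. *)
have [g [Gg Gbig]] : exists g, G g /\
    forall M N', exists2 k, (N' <= k)%N & M < `|J k g|.
  apply: contrapT => H; apply: (not_onto Sres) => y.
  apply: (fredholm_closed_range lK bK codimK) => e e0.
  have Grange g : G g -> exists x, K x = g.
    move=> Gg; apply: (fredholm_closed_range lK bK codimK) => e' e'0.
    have [M [N' HM]] : exists M N', forall k, (N' <= k)%N -> `|J k g| <= M.
      apply: contrapT => H'; apply: H; exists g; split => // M N'.
      apply: contrapT => H2; apply: H'; exists M, N' => k N'k.
      by rewrite leNgt; apply/negP => Mk; apply: H2; exists k.
    have M0 : 0 < `|M| + 1 by rewrite ltr_wpDl.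
    have [|N2 HN2] := @inv_natS_small R (e' / (`|M| + 1)).
      by rewrite divr_gt0.
    pose k := maxn N' N2; have [JP _ _] := Jres k.
    move: (JP g) (HM k (leq_maxl _ _)); move: (J k g) => w [dw wE] wM.
    exists ((alpha + 1) *: w - A w).
    rewrite /K (KR _ dw).2 -wE scalerDl [in X in _ - X]addrAC opprD addNKr.
    rewrite normrN normrZ gtr0_norm//.
    apply: (@le_trans _ _ (t k * (`|M| + 1))).
      rewrite ler_pM2l// (le_trans wM)//.
      by rewrite (le_trans (ler_norm M))// lerDl.
    by rewrite -ler_pdivlMr// HN2// leq_maxr.
  have [||z [zy [g1 [g2 [G1 G2 zE]]]]] := Gdense (O := ball y e).
  - by exists y; exact: ballxx.
  - exact: ball_open.
  have [x1 x1E] := Grange _ G1; have [x2 x2E] := Grange _ G2.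
  exists (x1 - x2); rewrite (linB lK) x1E x2E -zE distrC.
  by apply: ltW; rewrite -ball_normE in zy.
pose c (j : nat) := s2val (cid2 (Gbig j.+1%:R j)).
have cj j : (j <= c j)%N by rewrite /c; case: cid2.
have cbig j : j.+1%:R < `|J (c j) g| by rewrite /c; case: cid2.
pose r j := `|J (c j) g|.
have r0 j : 0 < r j by rewrite (lt_trans _ (cbig j)).
pose u j := (r j)^-1 *: J (c j) g.
have u1 j : `|u j| = 1 by rewrite /u /r normfZV// -normr_gt0 r0.
have [dA0 Al] := lA.
have du j : dom A (u j) /\ A (u j) = (r j)^-1 *: A (J (c j) g).
  have [JP _ _] := Jres (c j); have [dJ _] := JP g.
  have := Al (r j)^-1 _ _ dJ dA0.
  by rewrite !addr0 (linear_op0 lA) addr0.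
have Bu j : alpha *: u j - A (u j) = (r j)^-1 *: g - t (c j) *: u j.
  have [JP _ _] := Jres (c j).
  rewrite (du j).2 /u; move: (JP g); move: (J (c j) g) => w [dw wE].
  rewrite -wE [in RHS]scalerBr scalerDl scalerDr !scalerA.
  by rewrite [t _ * _]mulrC [alpha * _]mulrC [RHS]addrAC addrK.
have Bsmall e : 0 < e -> exists N', forall k, (N' <= k)%N ->
    `|alpha *: u k - A (u k)| <= e.
  move=> e0; have g0 : 0 < `|g| + 1 by rewrite ltr_wpDl.
  have [|N' HN'] := @inv_natS_small R (e / (`|g| + 1)); first by rewrite divr_gt0.
  exists N' => k N'k; rewrite Bu (le_trans (ler_normB _ _))//.
  rewrite (normrZ (r k)^-1 g) (normrZ (t (c k)) (u k)) u1 mulr1.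
  rewrite !gtr0_norm ?invr_gt0//.
  have tk : t (c k) <= k.+1%:R^-1.
    by rewrite lef_pV2 ?posrE// ler_nat ltnS.
  have rk : (r k)^-1 <= k.+1%:R^-1.
    by rewrite lef_pV2 ?posrE//; exact/ltW/cbig.
  apply: (@le_trans _ _ (k.+1%:R^-1 * (`|g| + 1))).
    by rewrite mulrDr mulr1 lerD// ler_wpM2r.
  by rewrite -ler_pdivlMr// HN'.
(* [u j = S (v j)], so that [K (v j)] is [(alpha - A) (u j)]. *)
pose v j := (alpha + 1) *: u j - A (u j).
have vE j : v j = u j + (alpha *: u j - A (u j)).
  by rewrite /v scalerDl scale1r addrAC addrC.
have Kv j : K (v j) = alpha *: u j - A (u j).
  by rewrite /K; have [_ ->] := KR _ (du j).1.
have [M KM] : exists M, forall j, `|v j| <= M.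
  exists (1 + (`|g| + 1)) => j; rewrite vE (le_trans (ler_normD _ _))// u1 lerD2l.
  rewrite Bu (le_trans (ler_normB _ _))//.
  rewrite (normrZ (r j)^-1 g) (normrZ (t (c j)) (u j)) u1 mulr1.
  rewrite !gtr0_norm ?invr_gt0// lerD//.
    rewrite ler_piMl// invf_le1// (le_trans _ (ltW (cbig j)))// ler1n//.
  by rewrite invf_le1// ler1n.
have Ksmall e : 0 < e -> exists N', forall k, (N' <= k)%N -> `|K (v k)| <= e.
  move=> e0; have [N' HN'] := Bsmall e e0.
  by exists N' => k N'k; rewrite Kv; exact: HN'.
have [w vw Kw] := fredholm_cluster lK bK codimK dimK KM Ksmall.
have uw : seq_cluster u w.
  apply: seq_cluster_shift vw => e e0; have [N' HN'] := Bsmall e e0.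
  by exists N' => k N'k; rewrite vE addrAC subrr add0r HN'.
have wS : w = S w by apply/eqP; rewrite -subr_eq0; apply/eqP.
exists g, w; split => //.
- exact: seq_cluster_norm u1 uw.
- have := KE w; rewrite -/(K w) Kw -wS => /eqP; rewrite eq_sym subr_eq0 => /eqP <-.
  by split => //; rewrite wS; exact: (SP w).1.
- move=> e e0; have [N' HN'] := inv_natS_small e0.
  have [k] := uw e e0 (maxn N' (Num.truncn e^-1)).
  rewrite geq_max => /andP[N'k ek] uk.
  exists (alpha + t (c k)), (J (c k)), (r k); split => //.
  + split; first by rewrite ltrDl.
    by rewrite lerD2l HN'// (leq_trans N'k).
  + apply: lt_trans (cbig k); by rewrite -truncn_le_nat.
Qed.

End SingularResolvent.


(** * From complex to real Fredholm operators *)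

Section ComplexFredholm.
Variables (R : realType) (X : normedModType R).

(** The vectors [b j] and [i b j], which span over the reals what the [b j] span
    over the complex numbers. *)
Let realify n (b : 'I_n -> complexification X) (i : 'I_(n + n)) : (X * X)%type :=
  match fintype.split i with
  | inl j => b j
  | inr j => (- (b j).2, (b j).1)
  end.

Let complex_lspan n (b : 'I_n -> complexification X) x :
  @lspan _ (complexification X) n b x -> @lspan R (X * X)%type _ (realify b) x.
Proof.
move=> [c ->].
exists (fun i => match fintype.split i with
  | inl j => complex.Re (c j) | inr j => complex.Im (c j) end).
rewrite big_split_ord/= -[RHS]big_split/=.
have -> : \sum_(i < n) c i *: b i = \sum_(i < n) (c i *: b i : (X * X)%type).
  by [].
apply: eq_bigr => i _; rewrite /realify.
rewrite -[lshift n i]/(unsplit (inl i)) -[rshift n i]/(unsplit (inr i)) !unsplitK.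
case: (c i) (b i) => p q [u v].
rewrite -[LHS]/(p *: u - q *: v, q *: u + p *: v).
rewrite -[RHS]/(p *: u + q *: (- v), p *: v + q *: u).
by rewrite scalerN [q *: u + _]addrC.
Qed.

Lemma complex_fredholm (A : operator X) (lambda : R[i]) :
  fredholm (shift_op lambda (complexify A)) ->
  fredholm (shift_op (complex.Re lambda) (rot_op A (complex.Im lambda))).
Proof.
move=> [[m [b kerb]] [m' [b' ranb]]]; split.
  exists (m + m)%N, (realify b) => x [dx Bx]; apply: complex_lspan.
  by apply: kerb; split => //; rewrite shift_complexifyE.
exists (m' + m')%N, (realify b') => x.
have [v [w [[z dz zv] /complex_lspan wb xE]]] := ranb x.
exists v, w; split => //; exists z => //.
by rewrite /= -shift_complexifyE.
Qed.

End ComplexFredholm.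

(** * Powers of the generator and positive functionals *)

Section OperatorPowers.
Variables (R : realType) (X : normedModType R) (A : operator X).
Hypothesis lA : linear_op A.

Lemma op_pow_linear n : linear_op (op_pow A n).
Proof.
elim: n => [|n IH]; first by split.
have [A0 Al] := lA; have [B0 Bl] := IH.
split; first by split => //=; rewrite -/(op_pow A n) (linear_op0 IH).
move=> a x y [/= dx dAx] [dy dAy].
have [d E] := Bl a _ _ dx dy; have [d' E'] := Al a _ _ dAx dAy.
by split; [split; rewrite /= ?E|rewrite /= E].
Qed.

Lemma op_pow_succ n x : dom (op_pow A n.+1) x ->
  [/\ dom A x, dom (op_pow A n) (A x) & op_pow A n (A x) = A (op_pow A n x)].
Proof.
elim: n => [|n IH] [d dA]; first by [].
have [dx dAx E] := IH d; split => //.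
  by split => //=; rewrite E.
by rewrite /= E.
Qed.

Lemma eigenvector_op_pow n x (rho : R) : dom A x -> A x = rho *: x ->
  dom (op_pow A n) x /\ op_pow A n x = rho ^+ n *: x.
Proof.
move=> dx Ax; elim: n => [|n [d E]]; first by rewrite expr0 scale1r.
have [d' E'] := linear_opZ (rho ^+ n) lA dx.
split; first by split => //=; rewrite E.
by rewrite /= E E' Ax scalerA exprSr.
Qed.

Variable T : R -> X -> X.
Hypotheses (CT : C0_semigroup T) (TA : is_generator T A).

Lemma op_pow_semigroup n t x : 0 <= t -> dom (op_pow A n) x ->
  dom (op_pow A n) (T t x) /\ op_pow A n (T t x) = T t (op_pow A n x).
Proof.
move=> t0; elim: n => [//|n IH] [d dA].
have [d' E] := IH d; have [d2 E2] := generator_commute CT TA t0 dA.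
by split; [split => //=; rewrite E|rewrite /= E].
Qed.

(** On the orbit of [x >= 0] the functional [f] is nonnegative, and it vanishes
    at time [0]; its derivative there is [f (A x)] since the difference
    quotients converge in the graph norm of the [n]-th power. *)
Lemma positive_functional_generator C n f x :
  positive_semigroup C T -> linear_functional (op_pow A n) f ->
  continuous_functional (op_pow A n) f ->
  positive_functional C (op_pow A n) f ->
  C x -> dom (op_pow A n.+1) x -> f x = 0 -> 0 <= f (A x).
Proof.
move=> CTp lf cf pf Cx dx fx0.
have [dAx dA E] := op_pow_succ dx; have [dnx dAnx] := dx.
have [_ genlim] := TA; have [Tl _ _ _] := CT.
have [B0 Bl] := op_pow_linear n.
have f0 : f 0 = 0.
  have := lf 1 0 0 B0 B0; rewrite scale1r addr0 mul1r => /eqP.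
  by rewrite -subr_eq0 opprD addrA subrr sub0r oppr_eq0 => /eqP.
apply/ler_addgt0Pr => e e0.
have [d d0 dP] := cf _ dA e e0.
have c1 := genlim x dAx; have c2 := genlim _ dAnx.
have [h [h0 H1 H2]] : exists h : R, [/\ 0 < h,
    `|A x - h^-1 *: (T h x - x)| < d / 2 &
    `|A (op_pow A n x) - h^-1 *: (T h (op_pow A n x) - op_pow A n x)| < d / 2].
  near (0 : R)^'+ => h; exists h; split.
  - by near: h; exact: nbhs_right_gt.
  - near: h; move/cvgrPdist_lt : c1; apply; by rewrite divr_gt0.
  - near: h; move/cvgrPdist_lt : c2; apply; by rewrite divr_gt0.
have lB := op_pow_linear n.
have hge := ltW h0; have [dT ET] := op_pow_semigroup hge dnx.
have [dTx ETx] := linear_opB lB dT dnx.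
have [dq Eq] := linear_opZ h^-1 lB dTx.
have fq : f (h^-1 *: (T h x - x)) = h^-1 * f (T h x).
  have := lf h^-1 _ _ dTx B0; rewrite addr0 f0 addr0 => ->.
  have := lf (-1) _ _ dnx dT.
  by rewrite scaleN1r addrC fx0 mulr0 add0r => ->.
have q0 : 0 <= f (h^-1 *: (T h x - x)).
  by rewrite fq mulr_ge0 ?invr_ge0//; apply: pf => //; exact: CTp.
have : `|f (h^-1 *: (T h x - x)) - f (A x)| < e.
  apply: dP => //; rewrite /graph_norm (linear_opB lB dq dA).2 Eq ETx ET E.
  by rewrite [ltRHS]splitr distrC ltrD// distrC.
by rewrite distrC => /ltW; rewrite ler_distl => /andP[+ _]; lra.
Unshelve. all: by end_near. Qed.

End OperatorPowers.

(** * The resolvent set on a horizontal line; cones *)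

Section ResolventSet.
Variables (R : realType) (V : completeNormedModType R) (A : operator V).
Hypothesis lA : linear_op A.

Lemma resolvent_near alpha J : is_resolvent A alpha J ->
  exists2 d : R, 0 < d & exists2 M : R, 0 < M & forall t, `|t| <= d ->
    exists2 J', is_resolvent A (alpha - t) J' & forall x, `|J' x| <= M * `|x|.
Proof.
move=> Jres; have [_ _ [M M0 JM]] := Jres.
exists (2 * M)^-1; first by rewrite invr_gt0 mulr_gt0.
exists (2 * M) => [|t td]; first by rewrite mulr_gt0.
have tM : `|t| * M <= 2^-1.
  by rewrite -ler_pdivlMr// -invfM.
have tM1 : `|t| * M < 1 by rewrite (le_lt_trans tM)// invf_lt1// ltr1n.
have [J' [J'res J'M _]] := resolvent_shift lA Jres JM (ltW M0) tM1.
exists J' => // x; rewrite (le_trans (J'M x))// ler_wpM2r//.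
rewrite ler_pdivrMr ?subr_gt0//; set r := `|t| * M in tM *.
have : 0 <= M * (2^-1 - r) by rewrite mulr_ge0 ?subr_ge0// ltW.
by lra.
Qed.

(** The set of singular points is closed by [resolvent_near] and bounded above,
    so it contains its supremum. *)
Lemma last_singular (a0 omega : R) :
  ~ (exists J, is_resolvent A a0 J) ->
  (forall mu, omega <= mu -> exists J, is_resolvent A mu J) ->
  exists alpha, [/\ a0 <= alpha, ~ (exists J, is_resolvent A alpha J) &
    forall mu, alpha < mu -> exists J, is_resolvent A mu J].
Proof.
move=> sing0 reg; pose S : set R := [set mu | ~ exists J, is_resolvent A mu J].
have Sub : ubound S omega.
  by move=> mu Smu; rewrite leNgt; apply/negP => /ltW/reg.
have hS : has_sup S by split; [exists a0 | exists omega].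
exists (sup S); split.
- by apply: sup_upper_bound.
- case=> J /resolvent_near[d d0 [M M0 HM]].
  have [mu Smu mud] := sup_adherent d0 hS.
  have mus : mu <= sup S by apply: sup_upper_bound.
  apply: Smu; have [|J' J'res _] := HM (sup S - mu).
    by rewrite ger0_norm ?subr_ge0// lerBlDr -lerBlDl ltW.
  by exists J'; rewrite opprB addrC subrK in J'res.
- move=> mu Smu; apply: contrapT => Hmu.
  by have := sup_upper_bound hS Hmu; rewrite leNgt Smu.
Qed.

End ResolventSet.

Section Cones.
Variables (R : realType) (X : completeNormedModType R) (C : set X).
Hypothesis CC : ordering_cone C.

Let C0 : C 0.
Proof.
have [_ _ _ CN] := CC.
by have : [set 0] (0 : X) by []; rewrite -CN => -[].
Qed.

Lemma ordering_cone_antisym x : C x -> C (- x) -> x = 0.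
Proof.
have [_ _ _ CN] := CC => Cx CNx.
suff : (C `&` [set - x | x in C]) x by rewrite CN.
by split => //; exists (- x) => //; rewrite opprK.
Qed.

(** For [w = ((u, v), y)] this says that [y] dominates the real part of every
    rotation of [u + i v]; in a Banach lattice, that [|u + i v| <= y]. *)
Definition modulus_cone : set (X * X * X) := [set w |
  forall c s : R, c ^+ 2 + s ^+ 2 = 1 -> C (w.2 + (c *: w.1.1 + s *: w.1.2))].

Definition pair_cone : set (X * X) := [set z | C z.1 /\ C z.2].

Let rotated_part (c s : R) (w : X * X * X) := w.2 + (c *: w.1.1 + s *: w.1.2).

Let rotated_part_linear c s : linear (rotated_part c s).
Proof.
move=> a x y; rewrite /rotated_part -[(a *: x + y).2]/(a *: x.2 + y.2).
rewrite -[(a *: x + y).1.1]/(a *: x.1.1 + y.1.1).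
rewrite -[(a *: x + y).1.2]/(a *: x.1.2 + y.1.2).
rewrite !scalerDr !scalerA [a * c]mulrC [a * s]mulrC.
by rewrite [X in _ + X = _]addrACA [LHS]addrACA.
Qed.

Let rotated_part_continuous c s : continuous (rotated_part c s).
Proof.
apply: (linear_bounded_cont (rotated_part_linear c s)).
apply: (@bounded_opW _ _ _ _ (1 + (`|c| + `|s|))) => x.
rewrite (le_trans (ler_normD _ _))// !mulrDl mul1r !prod_normE lerD//.
  by rewrite le_max lexx orbT.
rewrite (le_trans (ler_normD _ _))// !normrZ lerD//.
  by rewrite ler_wpM2l// !le_max lexx.
by rewrite ler_wpM2l// !le_max lexx orbT.
Qed.

Lemma modulus_cone_closed : closed_cone modulus_cone.
Proof.
have [Ccl CD CZ _] := CC; split.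
- have -> : modulus_cone = \bigcap_(p in [set p : R * R | p.1 ^+ 2 + p.2 ^+ 2 = 1])
      rotated_part p.1 p.2 @^-1` C.
    apply/seteqP; split => [w Kw [c s] /= cs|w Kw c s cs]; first exact: Kw.
    exact: (Kw (c, s)).
  apply: closed_bigI => -[c s] _.
  by apply: closed_comp => // w _; exact: rotated_part_continuous.
- by move=> c s _; rewrite -/(rotated_part c s 0) (lin0 (rotated_part_linear c s)).
- move=> x y Kx Ky c s cs.
  rewrite -/(rotated_part c s (x + y)) (linD (rotated_part_linear c s)).
  by apply: CD; [exact: Kx|exact: Ky].
- move=> a x a0 Kx c s cs.
  rewrite -/(rotated_part c s (a *: x)) (linZ (rotated_part_linear c s)).
  by apply: CZ => //; exact: Kx.
Qed.

Lemma pair_cone_closed : closed pair_cone.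
Proof.
have [Ccl CD CZ _] := CC.
have -> : pair_cone = (fst @^-1` C) `&` (snd @^-1` C) by [].
apply: closedI; apply: closed_comp => // z _; [exact: fst_cont|exact: snd_cont].
Qed.

Lemma pair_cone_fst_closed : closed_cone [set w : X * X * X | pair_cone w.1].
Proof.
have [Ccl CD CZ _] := CC; split => //.
- have -> : [set w : X * X * X | pair_cone w.1] = fst @^-1` pair_cone by [].
  apply: closed_comp => [w _|]; [exact: fst_cont|exact: pair_cone_closed].
- by move=> x y [x1 x2] [y1 y2]; split; apply: CD.
- by move=> a x a0 [x1 x2]; split; apply: CZ.
Qed.

Lemma total_cone_pair : total_cone C ->
  dense [set z | exists x y, [/\ pair_cone x, pair_cone y & z = x - y]].
Proof.
move=> Cd; have approx (x : X) (e : R) : 0 < e ->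
    exists a b, [/\ C a, C b & `|x - (a - b)| < e].
  move=> e0; have [||z [zx [a [b [Ca Cb zE]]]]] := Cd (ball x e).
  - by exists x; exact: ballxx.
  - exact: ball_open.
  by exists a, b; split=> //; rewrite -zE; rewrite -ball_normE in zx.
move=> U [[u v] Uuv] Uo.
have /nbhs_normP[e /= e0 eU] : nbhs (u, v) U by exact: open_nbhs_nbhs.
have [a [b [Ca Cb ab]]] := approx u e e0.
have [a' [b' [Ca' Cb' ab']]] := approx v e e0.
exists ((a, a') - (b, b')); split; last by exists (a, a'), (b, b').
by apply: eU; rewrite /= prod_normE gt_max; apply/andP.
Qed.

Lemma modulus_cone_pair g : pair_cone g -> modulus_cone (g, g.1 + g.2).
Proof.
have [_ CD CZ _] := CC.
move=> [g1 g2] c s cs /=.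
have -> : g.1 + g.2 + (c *: g.1 + s *: g.2) = (1 + c) *: g.1 + (1 + s) *: g.2.
  by rewrite !scalerDl !scale1r addrACA.
by apply: CD; apply: CZ => //; nra.
Qed.

Lemma modulus_cone0 u : modulus_cone (u, 0) -> u = 0.
Proof.
case: u => u v Kuv.
have H (c s : R) := Kuv c s; rewrite /= in H.
have u0 : u = 0.
  apply: ordering_cone_antisym.
    by have := H 1 0 ltac:(ring); rewrite scale1r scale0r addr0 add0r.
  by have := H (-1) 0 ltac:(ring); rewrite scaleN1r scale0r addr0 add0r.
have v0 : v = 0.
  apply: ordering_cone_antisym.
    by have := H 0 1 ltac:(ring); rewrite scale1r scale0r !add0r.
  by have := H 0 (-1) ltac:(ring); rewrite scaleN1r scale0r !add0r.
by rewrite u0 v0.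
Qed.

Variables (T : R -> X -> X) (CT : C0_semigroup T) (CTp : positive_semigroup C T).

(** A rotation of [u + i v] only permutes the conditions which define the cone,
    and the positive operator [T t] respects each of them. *)
Lemma modulus_cone_semigroup eta t : 0 <= t ->
  preserves modulus_cone (fun w => rot (eta * t) (triple T t w)).
Proof.
move=> t0 [[u v] y] Kw c s cs; rewrite /rot /triple /pair_fun /=.
have [lT _] : linear (T t) /\ continuous (T t) by case: CT => H _ _ _; exact: H.
set a := eta * t.
have := CTp t0 (Kw (c * cos a - s * sin a) (c * sin a + s * cos a) _).
rewrite /= !(linD lT) !(linZ lT); have -> : c *: (cos a *: T t u + sin a *: T t v) +
    s *: (cos a *: T t v - sin a *: T t u) =
    (c * cos a - s * sin a) *: T t u + (c * sin a + s * cos a) *: T t v.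
  rewrite !scalerDr scalerN !scalerDl scaleNr !scalerA.
  by rewrite -!addrA; congr (_ + _); rewrite addrA addrC.
apply; have := cos2Dsin2 a => E.
by rewrite -cs -[RHS]mulr1 -E; ring.
Qed.

Lemma pair_cone_semigroup t : 0 <= t ->
  preserves [set w : X * X * X | pair_cone w.1]
    (fun w => rot (0 * t) (triple T t w)).
Proof.
move=> t0 w [Cu Cv].
have -> : rot (0 * t) (triple T t w) = triple T t w by rewrite mul0r rot0.
by split; apply: CTp.
Qed.

End Cones.

(** * Positive eigenvectors and the spectral bound *)

Section PositiveSemigroup.
Variables (R : realType) (X : completeNormedModType R) (C : set X).
Variables (T : R -> X -> X) (A : operator X).
Hypotheses (CC : ordering_cone C) (Ctot : total_cone C) (CT : C0_semigroup T)
  (CTp : positive_semigroup C T) (TA : is_generator T A).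

Let lA : linear_op A. Proof. exact: generator_linear CT TA. Qed.

(** [mu + i eta] is in the resolvent set. *)
Definition regular (eta mu : R) := exists S, is_resolvent (rot_op A eta) mu S.

Lemma regularP (lambda : R[i]) :
  resolvent_set A lambda <-> regular (complex.Im lambda) (complex.Re lambda).
Proof. exact: resolvent_setP. Qed.

Lemma regular_large : exists omega : R, forall eta mu, omega <= mu ->
  regular eta mu.
Proof.
have [omega H] := block_resolvent_large CT TA.
exists omega => eta mu omu; have [J [Jres _]] := H eta mu omu.
by eexists; exact: pair_resolvent_fst lA Jres.
Qed.

Lemma regular_real mu : regular 0 mu -> exists J, is_resolvent A mu J.
Proof.
move=> [S]; rewrite rot_op0 => Sres.
by eexists; exact: pair_resolvent_fst lA Sres.
Qed.

(** [resolvent_positive] for [block eta]: the relations between vectors that the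
    rotated semigroup preserves are preserved by the pair of resolvents at
    [mu + i eta] and [mu], as long as both exist to the right of [a]. *)
Lemma resolvent_pair_preserves K eta a : closed_cone K ->
  (forall t, 0 <= t -> preserves K (fun w => rot (eta * t) (triple T t w))) ->
  (forall mu, a <= mu -> regular eta mu) ->
  (forall mu, a <= mu -> regular 0 mu) ->
  forall mu S J, a <= mu -> is_resolvent (rot_op A eta) mu S ->
    is_resolvent A mu J -> preserves K (pair_fun S J).
Proof.
move=> cK KT reg reg0 mu S J amu Sres Jres.
have [omega H] := block_resolvent_large CT TA.
apply: (@resolvent_positive _ _ (block A eta) K a omega _ cK _ _ mu) => //.
- by apply: pair_op_linear => //; exact: rot_op_linear.
- move=> nu anu; have [S' S'res] := reg nu anu.
  have [J' J'res] := regular_real (reg0 nu anu).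
  by exists (pair_fun S' J'); exact: pair_resolvent.
- move=> nu J' onu J'res w Kw; have [J2 [J2res J2K]] := H eta nu onu.
  by rewrite (resolvent_unique J'res J2res); exact: J2K.
- exact: pair_resolvent.
Qed.

(** Where the resolvents exist on the real axis they dominate those on the
    line of imaginary part [eta]. If the former stayed bounded near [alpha]
    while the latter blow up, the limit of the normalised vectors would be a
    unit vector dominated by [0], which the cone, being pointed, excludes. *)
Lemma singular_real_above eta alpha : ~ regular eta alpha ->
  (forall mu, alpha < mu -> regular eta mu) ->
  fredholm (shift_op alpha (rot_op A eta)) ->
  exists2 mu, alpha <= mu & ~ regular 0 mu.
Proof.
move=> sing reg fred; apply: contrapT => H.
have reg0 mu : alpha <= mu -> regular 0 mu.
  by move=> amu; apply: contrapT => Hmu; apply: H; exists mu.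
have lrot := rot_op_linear eta lA.
have [g [u [Gg u1 [du Au] clus]]] :=
  singular_resolvent_cluster lrot reg sing fred (total_cone_pair Ctot).
have [J0 J0res] := regular_real (reg0 alpha (lexx _)).
have [d d0 [M M0 HM]] := resolvent_near lA J0res.
have cK := modulus_cone_closed CC.
suff Ku : modulus_cone C (u, 0).
  have := modulus_cone0 CC Ku => u0.
  by move: u1; rewrite u0 normr0 => /esym/eqP; rewrite oner_eq0.
have [Kcl _ _ KZ] := cK.
have -> : modulus_cone C = closure (modulus_cone C) by exact/closure_id.
move=> U /nbhs_normP[e /= e0 eU].
pose h := g.1 + g.2.
have Mh : 0 < M * `|h| + 1 by rewrite ltr_wpDl// mulr_ge0// ltW.
(* Close to [alpha], the real resolvents are bounded by [M] and the first
   component is within [e]; the last bound on [e'] makes [r^-1 *: J h], the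
   dominating vector, smaller than [e]. *)
pose e' := Num.min d (Num.min e (e / (M * `|h| + 1))).
have e'0 : 0 < e' by rewrite !lt_min d0 e0 divr_gt0.
have [mu [S [r [[amu mue] Sres er Su]]]] := clus e' e'0.
have [|J Jres JM] := HM (alpha - mu).
  rewrite distrC ger0_norm ?subr_ge0 ?(ltW amu)// lerBlDl.
  by rewrite (le_trans mue)// lerD2l ge_min lexx.
rewrite opprB addrC subrK in Jres.
have Kg : modulus_cone C (S g, J h).
  apply: (@resolvent_pair_preserves _ eta mu cK _ _ _ mu S J _ _ _ (g, h)) => //.
  - by move=> t t0; exact: modulus_cone_semigroup.
  - by move=> nu munu; apply: reg; exact: lt_le_trans munu.
  - by move=> nu munu; apply: reg0; exact: le_trans (ltW amu) munu.
  - exact: modulus_cone_pair.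
have r0 : 0 < r by rewrite (lt_trans _ er)// invr_gt0.
have re' : r^-1 < e'.
  by rewrite -[ltRHS]invrK ltf_pV2 ?posrE ?invr_gt0.
exists (r^-1 *: S g, r^-1 *: J h); split.
  by apply: (KZ r^-1 (S g, J h)) => //; rewrite invr_ge0 ltW.
apply: eU; rewrite /= prod_normE gt_max /=; apply/andP; split.
  by rewrite distrC (lt_le_trans Su)// !ge_min lexx !orbT.
rewrite sub0r normrN normrZ gtr0_norm ?invr_gt0//.
apply: (@lt_le_trans _ _ (e' * (M * `|h| + 1))).
  apply: (@le_lt_trans _ _ (r^-1 * (M * `|h|))).
    by rewrite ler_wpM2l ?invr_ge0 ?(ltW r0).
  apply: (@lt_trans _ _ (r^-1 * (M * `|h| + 1))).
    by rewrite ltr_pM2l ?invr_gt0// ltrDl.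
  by rewrite ltr_pM2r.
by rewrite -ler_pdivlMr// !ge_min lexx !orbT.
Qed.

(** On the real axis the resolvents themselves are positive, hence so is the
    eigenvector at which [singular_resolvent_cluster] lets them cluster. *)
Lemma real_singular_eigenvector rho : ~ regular 0 rho ->
  (forall mu, rho < mu -> regular 0 mu) ->
  fredholm (shift_op rho (rot_op A 0)) ->
  exists x, [/\ C x, x != 0, dom A x & A x = rho *: x].
Proof.
move=> sing reg fred; have lrot := rot_op_linear 0 lA.
have [g [u [Gg u1 [[du1 du2] Au] clus]]] :=
  singular_resolvent_cluster lrot reg sing fred (total_cone_pair Ctot).
have cK := pair_cone_fst_closed CC.
have Ku : pair_cone C u.
  have Kcl := pair_cone_closed CC.
  have -> : pair_cone C = closure (pair_cone C) by exact/closure_id.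
  move=> U /nbhs_normP[e /= e0 eU].
  have [mu [S [r [[amu mue] Sres er Su]]]] := clus e e0.
  have r0 : 0 < r by rewrite (lt_trans _ er)// invr_gt0.
  have regmu nu : mu <= nu -> regular 0 nu.
    by move=> munu; apply: reg; exact: lt_le_trans munu.
  have [J Jres] := regular_real (regmu mu (lexx _)).
  have Kg : pair_cone C (S g).
    apply: (@resolvent_pair_preserves _ 0 mu cK _ regmu regmu mu S J _ _ _ (g, 0)) => //.
    by move=> t t0; exact: pair_cone_semigroup.
  exists (r^-1 *: S g); split; last by apply: eU; rewrite /= distrC.
  have [_ _ CZ _] := CC; case: Kg => k1 k2.
  have ri : 0 <= r^-1 by rewrite invr_ge0 ltW.
  by split; apply: CZ.
move: u Ku u1 du1 du2 Au {clus} => [v w] [/= Cv Cw] u1 dv dw.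
rewrite -[rho *: _]/(rho *: v, rho *: w) !scale0r addr0 subr0 => -[Av Aw].
have [v0|v0] := eqVneq v 0; last by exists v.
have [w0|w0] := eqVneq w 0; last by exists w.
by move: u1; rewrite v0 w0 normr0 => /esym/eqP; rewrite oner_eq0.
Qed.

(** From a spectral point with real part above [c] and the essential spectral
    bound, one moves to the right along a horizontal line to its last singular
    point, then to the real axis by [singular_real_above], and there to the
    last singular point. All these points are beyond the essential spectrum. *)
Lemma dominant_eigenvector (c : R) :
  ess_spectrum A = set0 \/ (ess_spectral_bound A < spectral_bound A)%E ->
  (c%:E < spectral_bound A)%E ->
  exists2 rho, c <= rho &
    exists x, [/\ C x, x != 0, dom A x & A x = rho *: x].
Proof.
move=> ess cs.
have [lambda [sl cl fredl]] : exists lambda, [/\ spectrum A lambda,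
    c < complex.Re lambda & forall mu, complex.Re lambda <= complex.Re mu ->
      fredholm (shift_op mu (complexify A))].
  case: ess => [E|E].
    have [_ [lambda sl <-] cl] := ereal_sup_gt cs.
    exists lambda; split => // mu _; apply: contrapT => Hmu.
    by have : ess_spectrum A mu by []; rewrite E.
  have : (Order.max c%:E (ess_spectral_bound A) < spectral_bound A)%E.
    by rewrite gt_max cs.
  move=> /ereal_sup_gt[_ [lambda sl <-]]; rewrite gt_max => /andP[cl el].
  exists lambda; split => // mu lmu; apply: contrapT => Hmu.
  have : ((complex.Re mu)%:E <= ess_spectral_bound A)%E.
    by apply: ereal_sup_ubound; exists mu.
  by rewrite leNgt (lt_le_trans el)// lee_fin.
have [omega reg_large] := regular_large.
have fred eta mu : complex.Re lambda <= mu ->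
    fredholm (shift_op mu (rot_op A eta)).
  move=> lmu; have := fredl (Complex mu eta) lmu.
  exact: complex_fredholm.
have [alpha [la sa ra]] : exists alpha, [/\ complex.Re lambda <= alpha,
    ~ regular (complex.Im lambda) alpha &
    forall mu, alpha < mu -> regular (complex.Im lambda) mu].
  apply: (last_singular (rot_op_linear _ lA) _ (reg_large _)).
  by move=> reg; apply: sl; apply/regularP.
have [mu amu smu] := singular_real_above sa ra (fred _ _ la).
have [rho [mrho srho rrho]] : exists rho, [/\ mu <= rho, ~ regular 0 rho &
    forall nu, rho < nu -> regular 0 nu].
  exact: (last_singular (rot_op_linear _ lA) smu (reg_large _)).
have lrho : complex.Re lambda <= rho by rewrite (le_trans la)// (le_trans amu).
exists rho; first by rewrite (le_trans _ lrho)// ltW.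
exact: real_singular_eigenvector srho rrho (fred _ _ lrho).
Qed.

Lemma spectral_bound_lt_pinfty : (spectral_bound A < +oo)%E.
Proof.
have [omega reg] := regular_large.
apply: le_lt_trans (ltry omega); apply: ge_ereal_sup => _ [lambda sl <-].
rewrite lee_fin leNgt; apply/negP => /ltW ol.
by apply: sl; apply/regularP; exact: reg.
Qed.

(** The resolvent [J] at [c] is positive, and [- x = J (A x - c *: x)]. *)
Lemma subeigenvector_zero (c : R) x : (spectral_bound A < c%:E)%E ->
  dom A x -> C x -> C (A x - c *: x) -> x = 0.
Proof.
move=> sc dx Cx CAx.
have reg mu : c <= mu -> regular 0 mu.
  move=> cmu; apply: contrapT => Hmu.
  have : spectrum A (Complex mu 0) by move=> /regularP.
  move=> smu; have : ((mu)%:E <= spectral_bound A)%E.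
    by apply: ereal_sup_ubound; exists (Complex mu 0).
  by rewrite leNgt (lt_le_trans sc)// lee_fin.
have [S Sres] := reg c (lexx _).
have [J Jres] := regular_real (reg c (lexx _)).
have S'res := pair_resolvent Jres Jres.
rewrite -rot_op0 in S'res.
have cK := pair_cone_fst_closed CC.
have C0 : C 0 by have [_ [] ] := cK.
have [CJ _] : pair_cone C (pair_fun J J (A x - c *: x, 0)).
  apply: (@resolvent_pair_preserves _ 0 c cK _ reg reg c _ J _ S'res Jres
    ((A x - c *: x, 0), 0)) => //.
  by move=> t t0; exact: pair_cone_semigroup.
apply: (ordering_cone_antisym CC Cx).
have lJ := resolvent_linear lA Jres; have [_ JK _] := Jres.
by rewrite /= -opprB -(sub0r (c *: x - _)) (linB lJ) (lin0 lJ) JK// sub0r in CJ.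
Qed.

End PositiveSemigroup.

Theorem theorem6p5 (R : realType) (X : completeNormedModType R) (C : set X)
    (T : R -> X -> X) (A : operator X) (n : nat) (F : set (X -> R)) :
  ordering_cone C -> total_cone C ->
  C0_semigroup T -> positive_semigroup C T -> is_generator T A ->
  (ess_spectrum A = set0 \/ (ess_spectral_bound A < spectral_bound A)%E) ->
  F !=set0 ->
  (forall f, F f -> [/\ linear_functional (op_pow A n) f,
                        continuous_functional (op_pow A n) f &
                        positive_functional C (op_pow A n) f]) ->
  determines_positivity C (op_pow A n) F ->
  (spectral_bound A < +oo)%E /\
  spectral_bound A =
    ereal_sup [set ereal_inf [set (f (A x) / f x)%:E
                             | f in [set f | F f /\ f x != 0]]
              | x in [set x | [/\ C x, x != 0 & dom (op_pow A n.+1) x]]].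
Proof.
move=> CC Ctot CT CTp TA ess F0 FP Fdet.
have lA := generator_linear CT TA.
have sfin := spectral_bound_lt_pinfty CT TA; split => //.
have lB := op_pow_linear lA n.
apply/eqP; rewrite eq_le; apply/andP; split.
  rewrite leNgt; apply/negP => lt.
  set s' := ereal_sup _ in lt.
  (* An eigenvector with an eigenvalue [rho >= c] forces the supremum up to [rho]. *)
  have [c cs sc] : exists2 c : R, (c%:E < spectral_bound A)%E & (s' < c%:E)%E.
    move: sfin lt; case: (spectral_bound A) => [s| |] // _; case: s' => [r| |] //.
    - rewrite lte_fin => rs; exists ((r + s) / 2); rewrite lte_fin; lra.
    - by move=> _; exists (s - 1); rewrite ?ltNyr// lte_fin; lra.
  have [rho crho [x [Cx x0 dx Ax]]] := dominant_eigenvector CC Ctot CT CTp TA ess cs.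
  have [dxn _] := eigenvector_op_pow lA n.+1 dx Ax.
  have [dxn' _] := eigenvector_op_pow lA n dx Ax.
  move: sc; rewrite ltNge => /negP; apply.
  apply: (@le_trans _ _ rho%:E); first by rewrite lee_fin.
  apply: le_trans (ereal_sup_ubound _); last by exists x.
  apply: le_ereal_inf_tmp => _ [f [Ff fx0] <-]; rewrite lee_fin.
  have [lf _ _] := FP f Ff.
  have f0 : f 0 = 0.
    have := lf 1 0 0 lB.1 lB.1; rewrite scale1r addr0 mul1r => /eqP.
    by rewrite -subr_eq0 opprD addrA subrr sub0r oppr_eq0 => /eqP.
  have := lf rho x 0 dxn' lB.1; rewrite addr0 f0 addr0 -Ax => ->.
  by rewrite mulfK.
apply: ge_ereal_sup => _ [x [Cx x0 dx] <-]; rewrite leNgt; apply/negP => lt.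
set I := ereal_inf _ in lt.
(* All the quotients for [x] are at least [c], that is, [A x >= c *: x]. *)
have [c sc cI] : exists2 c : R, (spectral_bound A < c%:E)%E & (c%:E <= I)%E.
  move: sfin lt; case: (spectral_bound A) => [s| |] // _; case: I => [r| |] //.
  - by move=> lt; exists r.
  - by move=> _; exists (s + 1); rewrite ?leey// lte_fin; lra.
  - by move=> lt; exists r.
  - by move=> _; exists 0; rewrite ?leey// ltNyr.
have [dAx dA _] := op_pow_succ dx.
have [dnx _] := dx.
have [dcx _] := linear_opZ c lB dnx.
have [dAcx _] := linear_opB lB dA dcx.
apply: (negP x0); apply/eqP.
apply: (subeigenvector_zero CC CT CTp TA sc dAx Cx).
apply: Fdet => // f Ff; have [lf cf pf] := FP f Ff.
have -> : f (A x - c *: x) = f (A x) - c * f x.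
  have -> : A x - c *: x = (- c) *: x + A x by rewrite scaleNr addrC.
  by rewrite lf// mulNr addrC.
rewrite subr_ge0; have [fx0|fx0] := eqVneq (f x) 0.
  rewrite fx0 mulr0.
  exact: (positive_functional_generator lA CT TA CTp lf cf pf Cx dx fx0).
have fx : 0 < f x by rewrite lt_neqAle eq_sym fx0 pf.
rewrite -ler_pdivlMr// -lee_fin (le_trans cI)//.
by apply: ereal_inf_lbound; exists f.
Qed.
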